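(* Let $L$ be an $n$-dimensional nilpotent Lie algebra. Then $L$ has the property $s(L)=2$, i.e. $\dim M(L)=\frac{1}{2}(n-1)(n-2)-1$, if and only if $L$ is isomorphic to one of the following Lie algebras: (i) $L(3,4,1,4)$; (ii) $L(4,5,2,4)\oplus A(1)$; (iii) $H(m)\oplus A(n-2m-1)$ for some integer $m\geq 2$ (with $2m+1\le n$).
   Context: All Lie algebras are finite dimensional over a fixed field. $M(L)$ denotes the Schur multiplier of $L$: if $L\cong F/R$ with $F$ a free Lie algebra and $R$ an ideal of $F$, then $M(L)=(R\cap [F,F])/[R,F]$ (an abelian Lie algebra independent, up to isomorphism, of the chosen free presentation). For an $n$-dimensional Lie algebra $L$, the integer $s(L)$ is defined by $s(L)=\frac{1}{2}(n-1)(n-2)+1-\dim M(L)$. $A(k)$ is the abelian Lie algebra of dimension $k$ (with $A(0)=0$). $H(m)$ is the Heisenberg Lie algebra of dimension $2m+1$, with basis $x_1,\dots,x_m,y_1,\dots,y_m,z$ and only nonzero basis brackets (up to antisymmetry) $[x_i,y_i]=z$ for $1\le i\le m$. $L(3,4,1,4)$ is the 4-dimensional Lie algebra with basis $x,y,z,c$ and only nonzero basis brackets (up to antisymmetry) $[x,y]=z$, $[x,z]=c$. $L(4,5,2,4)$ is the 5-dimensional Lie algebra with basis $x,y,z,c,d$ and only nonzero basis brackets (up to antisymmetry) $[x,y]=c$, $[x,z]=d$. The symbol $\oplus$ denotes direct sum of Lie algebras.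
   Formalization: The formal statement assumes n ≥ 1: the zero Lie algebra (n = 0) is nilpotent with M(L) = 0, so s(L) = 2, yet it is not in the list, and the claim as worded fails for it alone. *)

(* Defs.v *)
From HB Require Import structures.
From mathcomp Require Import all_boot all_order all_algebra.
From mathcomp Require Import generic_quotient ring boolp classical_sets.

Set Implicit Arguments.
Unset Strict Implicit.
Unset Printing Implicit Defensive.

Import GRing.Theory.
Local Open Scope ring_scope.
Local Open Scope classical_set_scope.
Local Open Scope quotient_scope.

(* The axiom [x, x] = 0 (rather than antisymmetry) is the correct one in every
   characteristic, including 2. *)
HB.mixin Record Lmodule_isLie (K : fieldType) V of GRing.Lmodule K V := {
  lie : V -> V -> V;
  lie_linearl : forall (a : K) x y z, lie (a *: x + y) z = a *: lie x z + lie y z;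
  lie_linearr : forall (a : K) x y z, lie x (a *: y + z) = a *: lie x y + lie x z;
  liexx : forall x, lie x x = 0;
  lie_jacobi : forall x y z,
    lie x (lie y z) + lie y (lie z x) + lie z (lie x y) = 0
}.

#[short(type="lieAlgType")]
HB.structure Definition LieAlgebra (K : fieldType) :=
  {V of Lmodule_isLie K V & GRing.Lmodule K V}.

#[short(type="finLieAlgType")]
HB.structure Definition FinLieAlgebra (K : fieldType) :=
  {V of Lmodule_isLie K V & Vector K V}.

Section Morphisms.
Context (K : fieldType).

Definition lie_morphism (L1 L2 : lieAlgType K) (f : L1 -> L2) : Prop :=
  linear f /\ {morph f : x y / lie x y >-> lie x y}.

Definition lie_isomorphic (L1 L2 : lieAlgType K) : Prop :=
  exists f : L1 -> L2, lie_morphism f /\ bijective f.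

End Morphisms.

Section Subspaces.
Context (K : fieldType).

Definition lin_span (V : lmodType K) (S : set V) : set V :=
  [set v | exists n (a : 'I_n -> K) (s : 'I_n -> V),
     (forall i, S (s i)) /\ v = \sum_(i < n) a i *: s i].

Definition lie_comm (L : lieAlgType K) (A B : set L) : set L :=
  lin_span [set v | exists x y, [/\ A x, B y & v = lie x y]].

Definition lower_central (L : lieAlgType K) (k : nat) : set L :=
  iter k (lie_comm [set: L]) [set: L].
Arguments lower_central : clear implicits.

Definition nilpotent_lie (L : lieAlgType K) : Prop :=
  exists k, lower_central L k `<=` [set 0].

(* b induces a basis of the quotient space U / W *)
Definition basis_mod (V : lmodType K) (U W : set V) (d : nat) (b : 'I_d -> V) :=
  [/\ forall i, U (b i),
      forall a : 'I_d -> K, W (\sum_i a i *: b i) -> forall i, a i = 0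
    & forall u, U u -> exists a : 'I_d -> K, W (u - \sum_i a i *: b i)].

(* dim (U / W); by convention 0 if U / W is infinite dimensional *)
Definition dim_mod (V : lmodType K) (U W : set V) : nat :=
  xget 0%N [set d | exists b : 'I_d -> V, basis_mod U W b].

Lemma lin_span_comb (V : lmodType K) (S : set V) n (a : 'I_n -> K) (w : 'I_n -> V) :
  (forall i, lin_span S (w i)) -> lin_span S (\sum_i a i *: w i).
Proof.
have add0 u v c : lin_span S u -> lin_span S v -> lin_span S (u + c *: v).
  move=> [p [al [s [hs ->]]]] [q [be [t [ht ->]]]].
  exists (p + q)%N,
    (fun i => match split i with inl j => al j | inr j => c * be j end),
    (fun i => match split i with inl j => s j | inr j => t j end).
  split; first by move=> i; case: (split i).
  rewrite big_split_ord /= scaler_sumr; congr (_ + _); apply: eq_bigr => i _.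
    by have /= -> := unsplitK (inl i : 'I_p + 'I_q).
  by have /= -> := unsplitK (inr i : 'I_p + 'I_q); rewrite scalerA.
move=> hw; elim/big_rec: _ => [|i u _ hu]; last by rewrite addrC; apply: add0.
by exists 0%N, (fun=> 0), (fun=> 0); split; [case | rewrite big_ord0].
Qed.

Lemma basis_mod_le (V : lmodType K) (U S : set V) d e
    (b : 'I_d -> V) (c : 'I_e -> V) :
  basis_mod U (lin_span S) b -> basis_mod U (lin_span S) c -> (e <= d)%N.
Proof.
move=> [_ _ gb] [Uc fc _].
have /choice [A hA] i := gb _ (Uc i).
pose M := \matrix_(i < e, j < d) A i j.
suff /eqP <- : row_free M by apply: rank_leq_col.
rewrite -kermx_eq0; apply/eqP/row_matrixP => i; rewrite row0.
set x := row i (kermx M).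
have xM : x *m M = 0 by rewrite /x -row_mul mulmx_ker row0.
apply/rowP => j; rewrite [RHS]mxE; apply: (fc (fun j => x 0 j)) => //.
have -> : \sum_i x 0 i *: c i
    = \sum_i x 0 i *: (c i - \sum_k A i k *: b k).
  under [RHS]eq_bigr do rewrite scalerBr scaler_sumr.
  rewrite sumrB exchange_big /= [X in _ - X]big1 ?subr0 // => k _.
  under eq_bigr do rewrite scalerA.
  rewrite -scaler_suml; have /matrixP/(_ 0 k) := xM; rewrite !mxE => E.
  rewrite (_ : \sum_i0 _ = 0) ?scale0r // -[RHS]E.
  by apply: eq_bigr => l _; rewrite !mxE.
by apply: lin_span_comb.
Qed.

Lemma dim_modE (V : lmodType K) (U S : set V) d (b : 'I_d -> V) :
  basis_mod U (lin_span S) b -> dim_mod U (lin_span S) = d.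
Proof.
move=> hb; apply: xget_unique; first by exists b.
move=> e [c hc]; apply/eqP; rewrite eqn_leq.
by rewrite (basis_mod_le hb hc) (basis_mod_le hc hb).
Qed.

End Subspaces.

Section Schur.
Context (K : fieldType).

Definition is_free_lie (X : Type) (F : lieAlgType K) (inc : X -> F) : Prop :=
  forall (G : lieAlgType K) (g : X -> G),
    exists! f : F -> G, lie_morphism f /\ forall x, f (inc x) = g x.

(* L ~ F / R with F free on some set of generators and R = ker fp_proj *)
Record free_presentation (L : lieAlgType K) := FreePresentation {
  fp_gen : Type;
  fp_free : lieAlgType K;
  fp_inc : fp_gen -> fp_free;
  fp_freeP : is_free_lie fp_inc;
  fp_proj : fp_free -> L;
  fp_projM : lie_morphism fp_proj;
  fp_projS : forall l, exists x, fp_proj x = l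
}.
Arguments fp_inc {L} f _.
Arguments fp_proj {L} f _.

Definition fp_rel (L : lieAlgType K) (P : free_presentation L) :
  set (fp_free P) := [set x | fp_proj P x = 0].
Arguments fp_rel {L} P _.

(* dim M(L), where M(L) = (R `&` [F, F]) / [R, F] *)
Definition schur_dim (L : lieAlgType K) (P : free_presentation L) : nat :=
  dim_mod (fp_rel P `&` lie_comm [set: fp_free P] [set: fp_free P])
          (lie_comm (fp_rel P) [set: fp_free P]).

Definition s_invariant (L : finLieAlgType K) (P : free_presentation L) : rat :=
  let n : rat := (\dim {:L})%:R in
  2^-1 * (n - 1) * (n - 2) + 1 - (schur_dim P)%:R.

End Schur.

(* Existence of free Lie algebras: formal Lie expressions modulo the smallest
   congruence containing the axioms. *)
Section FreeLie.
Context (K : fieldType) (X : Type).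

Inductive lie_term : Type :=
| Gen of X
| Zero
| Add of lie_term & lie_term
| Scale of K & lie_term
| Br of lie_term & lie_term.

HB.instance Definition _ := gen_eqMixin lie_term.
HB.instance Definition _ := gen_choiceMixin lie_term.

Inductive lie_cong : lie_term -> lie_term -> Prop :=
| lc_refl s : lie_cong s s
| lc_sym s t : lie_cong s t -> lie_cong t s
| lc_trans t s u : lie_cong s t -> lie_cong t u -> lie_cong s u
| lc_add s s' t t' : lie_cong s s' -> lie_cong t t' ->
    lie_cong (Add s t) (Add s' t')
| lc_scale a s s' : lie_cong s s' -> lie_cong (Scale a s) (Scale a s')
| lc_br s s' t t' : lie_cong s s' -> lie_cong t t' ->
    lie_cong (Br s t) (Br s' t')
| lc_addA s t u : lie_cong (Add s (Add t u)) (Add (Add s t) u)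
| lc_addC s t : lie_cong (Add s t) (Add t s)
| lc_add0 s : lie_cong (Add Zero s) s
| lc_addN s : lie_cong (Add (Scale (-1) s) s) Zero
| lc_scaleA a b s : lie_cong (Scale a (Scale b s)) (Scale (a * b) s)
| lc_scale1 s : lie_cong (Scale 1 s) s
| lc_scaleDr a s t : lie_cong (Scale a (Add s t)) (Add (Scale a s) (Scale a t))
| lc_scaleDl a b s : lie_cong (Scale (a + b) s) (Add (Scale a s) (Scale b s))
| lc_brl a s t u :
    lie_cong (Br (Add (Scale a s) t) u) (Add (Scale a (Br s u)) (Br t u))
| lc_brr a s t u :
    lie_cong (Br s (Add (Scale a t) u)) (Add (Scale a (Br s t)) (Br s u))
| lc_brxx s : lie_cong (Br s s) Zero
| lc_jacobi s t u :
    lie_cong (Add (Add (Br s (Br t u)) (Br t (Br u s))) (Br u (Br s t))) Zero.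

Definition lie_congb : rel lie_term := fun s t => `[< lie_cong s t >].

Lemma lie_congb_refl : reflexive lie_congb.
Proof. by move=> s; apply/asboolP; apply: lc_refl. Qed.
Lemma lie_congb_sym : symmetric lie_congb.
Proof. by move=> s t; apply/asboolP/asboolP; apply: lc_sym. Qed.
Lemma lie_congb_trans : transitive lie_congb.
Proof.
by move=> t s u /asboolP st /asboolP tu; apply/asboolP; apply: (lc_trans st).
Qed.

Canonical lie_cong_equiv :=
  EquivRel lie_congb lie_congb_refl lie_congb_sym lie_congb_trans.

Definition free_lie : Type := {eq_quot lie_cong_equiv}.
HB.instance Definition _ := Choice.on free_lie.

Definition fl_class (s : lie_term) : free_lie := \pi_{eq_quot lie_cong_equiv} s.
Definition fl_repr (u : free_lie) : lie_term := repr (u : {eq_quot lie_cong_equiv}).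

Lemma fl_reprK u : fl_class (fl_repr u) = u.
Proof. exact: reprK. Qed.

Lemma fl_eq s t : fl_class s = fl_class t <-> lie_cong s t.
Proof.
split; first by move/eqmodP => /asboolP.
by move=> h; apply/eqmodP; apply/asboolP.
Qed.

Lemma fl_repr_cong s : lie_cong (fl_repr (fl_class s)) s.
Proof. by apply/fl_eq; rewrite fl_reprK. Qed.

Definition fl_add u v := fl_class (Add (fl_repr u) (fl_repr v)).
Definition fl_scale a u := fl_class (Scale a (fl_repr u)).
Definition fl_br u v := fl_class (Br (fl_repr u) (fl_repr v)).

Lemma fl_addE s t : fl_add (fl_class s) (fl_class t) = fl_class (Add s t).
Proof. by apply/fl_eq/lc_add; apply: fl_repr_cong. Qed.
Lemma fl_scaleE a s : fl_scale a (fl_class s) = fl_class (Scale a s).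
Proof. by apply/fl_eq/lc_scale; apply: fl_repr_cong. Qed.
Lemma fl_brE s t : fl_br (fl_class s) (fl_class t) = fl_class (Br s t).
Proof. by apply/fl_eq/lc_br; apply: fl_repr_cong. Qed.

Definition fl_opE := (fl_addE, fl_scaleE, fl_brE).

Lemma fl_ind (P : free_lie -> Prop) : (forall s, P (fl_class s)) -> forall u, P u.
Proof. by move=> h u; rewrite -[u]fl_reprK. Qed.

Fact fl_addA : associative fl_add.
Proof.
by do 3!elim/fl_ind => ?; rewrite !fl_opE; apply/fl_eq/lc_addA.
Qed.
Fact fl_addC : commutative fl_add.
Proof. by do 2!elim/fl_ind => ?; rewrite !fl_opE; apply/fl_eq/lc_addC. Qed.
Fact fl_add0 : left_id (fl_class Zero) fl_add.
Proof. by elim/fl_ind => ?; rewrite !fl_opE; apply/fl_eq/lc_add0. Qed.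
Fact fl_addN : left_inverse (fl_class Zero) (fl_scale (-1)) fl_add.
Proof. by elim/fl_ind => ?; rewrite !fl_opE; apply/fl_eq/lc_addN. Qed.

HB.instance Definition _ :=
  GRing.isZmodule.Build free_lie fl_addA fl_addC fl_add0 fl_addN.

Fact fl_scaleA a b u : fl_scale a (fl_scale b u) = fl_scale (a * b) u.
Proof. by elim/fl_ind: u => ?; rewrite !fl_opE; apply/fl_eq/lc_scaleA. Qed.
Fact fl_scale1 : left_id 1 fl_scale.
Proof. by elim/fl_ind => ?; rewrite !fl_opE; apply/fl_eq/lc_scale1. Qed.
Fact fl_scaleDr : right_distributive fl_scale +%R.
Proof.
move=> a; do 2!elim/fl_ind => ?; rewrite /+%R /= !fl_opE.
by apply/fl_eq/lc_scaleDr.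
Qed.
Fact fl_scaleDl u : {morph fl_scale^~ u : a b / a + b}.
Proof.
move=> a b; elim/fl_ind: u => s.
change (fl_scale (a + b) (fl_class s)
  = fl_add (fl_scale a (fl_class s)) (fl_scale b (fl_class s))).
by rewrite !fl_opE; apply/fl_eq/lc_scaleDl.
Qed.

HB.instance Definition _ :=
  GRing.Zmodule_isLmodule.Build K free_lie fl_scaleA fl_scale1 fl_scaleDr fl_scaleDl.

Lemma fl_classD s t : fl_class (Add s t) = fl_class s + fl_class t.
Proof. by rewrite -fl_addE. Qed.
Lemma fl_classZ a s : fl_class (Scale a s) = a *: fl_class s.
Proof. by rewrite -fl_scaleE. Qed.
Lemma fl_class0 : fl_class Zero = 0.
Proof. by []. Qed.

Fact fl_brl (a : K) (x y z : free_lie) :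
  fl_br (a *: x + y) z = a *: fl_br x z + fl_br y z.
Proof.
elim/fl_ind: x => x; elim/fl_ind: y => y; elim/fl_ind: z => z.
rewrite -fl_classZ -fl_classD !fl_brE -fl_classZ -fl_classD.
exact/fl_eq/lc_brl.
Qed.
Fact fl_brr (a : K) (x y z : free_lie) :
  fl_br x (a *: y + z) = a *: fl_br x y + fl_br x z.
Proof.
elim/fl_ind: x => x; elim/fl_ind: y => y; elim/fl_ind: z => z.
rewrite -fl_classZ -fl_classD !fl_brE -fl_classZ -fl_classD.
exact/fl_eq/lc_brr.
Qed.
Fact fl_brxx (x : free_lie) : fl_br x x = 0.
Proof. by elim/fl_ind: x => x; rewrite fl_brE; apply/fl_eq/lc_brxx. Qed.
Fact fl_jacobi (x y z : free_lie) :
  fl_br x (fl_br y z) + fl_br y (fl_br z x) + fl_br z (fl_br x y) = 0.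
Proof.
elim/fl_ind: x => x; elim/fl_ind: y => y; elim/fl_ind: z => z.
rewrite !fl_brE -!fl_classD; exact/fl_eq/lc_jacobi.
Qed.

HB.instance Definition _ :=
  Lmodule_isLie.Build K free_lie fl_brl fl_brr fl_brxx fl_jacobi.

Lemma fl_classBr s t : fl_class (Br s t) = lie (fl_class s) (fl_class t).
Proof. by rewrite -fl_brE. Qed.

Definition free_gen (x : X) : free_lie := fl_class (Gen x).

Fixpoint lie_eval (G : lieAlgType K) (g : X -> G) (s : lie_term) : G :=
  match s with
  | Gen x => g x
  | Zero => 0
  | Add s t => lie_eval g s + lie_eval g t
  | Scale a s => a *: lie_eval g s
  | Br s t => lie (lie_eval g s) (lie_eval g t)
  end.

Lemma lie_eval_cong (G : lieAlgType K) (g : X -> G) s t :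
  lie_cong s t -> lie_eval g s = lie_eval g t.
Proof.
elim=> //=.
- by move=> {}t {}s u _ -> _ ->.
- by move=> {}s s' {}t t' _ -> _ ->.
- by move=> a {}s s' _ ->.
- by move=> {}s s' {}t t' _ -> _ ->.
- by move=> *; rewrite addrA.
- by move=> *; rewrite addrC.
- by move=> *; rewrite add0r.
- by move=> *; rewrite scaleN1r addNr.
- by move=> *; rewrite scalerA.
- by move=> *; rewrite scale1r.
- by move=> *; rewrite scalerDr.
- by move=> *; rewrite scalerDl.
- by move=> *; rewrite lie_linearl.
- by move=> *; rewrite lie_linearr.
- by move=> *; rewrite liexx.
- by move=> *; rewrite lie_jacobi.
Qed.

Lemma free_lieP : is_free_lie free_gen.
Proof.
move=> G g; pose f u := lie_eval g (fl_repr u).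
have fE s : f (fl_class s) = lie_eval g s.
  by apply: lie_eval_cong; apply: fl_repr_cong.
exists f; split.
  split; last by move=> x; rewrite fE.
  split.
    move=> a u v; elim/fl_ind: u => s; elim/fl_ind: v => t.
    by rewrite -fl_classZ -fl_classD !fE.
  move=> u v; elim/fl_ind: u => s; elim/fl_ind: v => t.
  by rewrite -fl_classBr !fE.
move=> h [[hl hb] hg]; apply/funext; elim/fl_ind => s; rewrite fE.
have h0 : h 0 = 0.
  by have := hl (-1) 0 0; rewrite scaler0 addr0 scaleN1r addNr.
elim: s => [x||s IHs t IHt|a s IH|s IHs t IHt] /=.
- by rewrite -/(free_gen x) hg.
- by rewrite fl_class0 h0.
- by rewrite IHs IHt fl_classD -[fl_class s]scale1r hl !scale1r.
- by rewrite IH fl_classZ -[_ *: fl_class s]addr0 hl h0 addr0.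
- by rewrite IHs IHt fl_classBr hb.
Qed.

End FreeLie.

Lemma free_presentation_exists (K : fieldType) (L : lieAlgType K) :
  inhabited (free_presentation L).
Proof.
have [f [[fM fE] _]] := free_lieP (@idfun L).
apply: (inhabits (@FreePresentation K L _ _ _ (@free_lieP K L) f fM _)).
by move=> l; exists (free_gen K l); rewrite fE.
Qed.

Section DirectSum.
Context (K : fieldType).

Section Lie.
Context (L1 L2 : lieAlgType K).
Implicit Types u v w : (L1 * L2)%type.

Definition dsum_lie u v : (L1 * L2)%type := (lie u.1 v.1, lie u.2 v.2).

Fact dsum_linearl (a : K) u v w :
  dsum_lie (a *: u + v) w = a *: dsum_lie u w + dsum_lie v w.
Proof. by rewrite /dsum_lie /= !lie_linearl. Qed.
Fact dsum_linearr (a : K) u v w :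
  dsum_lie u (a *: v + w) = a *: dsum_lie u v + dsum_lie u w.
Proof. by rewrite /dsum_lie /= !lie_linearr. Qed.
Fact dsum_liexx u : dsum_lie u u = 0.
Proof. by rewrite /dsum_lie !liexx. Qed.
Fact dsum_jacobi u v w :
  dsum_lie u (dsum_lie v w) + dsum_lie v (dsum_lie w u)
  + dsum_lie w (dsum_lie u v) = 0.
Proof. by congr (_, _); apply: lie_jacobi. Qed.

HB.instance Definition _ := Lmodule_isLie.Build K (L1 * L2)%type
  dsum_linearl dsum_linearr dsum_liexx dsum_jacobi.
End Lie.

HB.instance Definition _ (L1 L2 : finLieAlgType K) := Vector.on (L1 * L2)%type.

End DirectSum.

Section AbelianLie.
Context (K : fieldType) (k : nat).

Definition abelian_lie : Type := 'rV[K]_k.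
HB.instance Definition _ := Vector.on abelian_lie.
Implicit Types u v w : abelian_lie.

Definition abelian_br u v : abelian_lie := 0.

Fact abelian_linearl (a : K) u v w :
  abelian_br (a *: u + v) w = a *: abelian_br u w + abelian_br v w.
Proof. by rewrite /abelian_br scaler0 addr0. Qed.
Fact abelian_linearr (a : K) u v w :
  abelian_br u (a *: v + w) = a *: abelian_br u v + abelian_br u w.
Proof. by rewrite /abelian_br scaler0 addr0. Qed.
Fact abelian_xx u : abelian_br u u = 0. Proof. by []. Qed.
Fact abelian_jacobi u v w :
  abelian_br u (abelian_br v w) + abelian_br v (abelian_br w u)
  + abelian_br w (abelian_br u v) = 0.
Proof. by rewrite /abelian_br !addr0. Qed.

HB.instance Definition _ := Lmodule_isLie.Build K abelian_lie
  abelian_linearl abelian_linearr abelian_xx abelian_jacobi.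
End AbelianLie.

(* (p, q, c) stands for \sum_i p_i x_i + \sum_i q_i y_i + c z, so that
   [(p, q, c), (p', q', c')] = (\sum_i (p_i q'_i - p'_i q_i)) z. *)
Section Heisenberg.
Context (K : fieldType) (m : nat).

Definition heisenberg : Type := ('rV[K]_m * 'rV[K]_m * K^o)%type.
HB.instance Definition _ := Vector.on heisenberg.
Implicit Types u v w : heisenberg.

Definition heis_br u v : heisenberg :=
  (0, 0, \sum_(i < m) (u.1.1 0 i * v.1.2 0 i - v.1.1 0 i * u.1.2 0 i)).

Fact heis_linearl (a : K) u v w :
  heis_br (a *: u + v) w = a *: heis_br u w + heis_br v w.
Proof.
congr (_, _, _); rewrite /= ?scaler0 ?addr0 //.
rewrite [_ *: (\sum_(_ < _) _)]mulr_sumr -big_split /=.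
by apply: eq_bigr => i _; rewrite !mxE /GRing.scale /=; ring.
Qed.
Fact heis_linearr (a : K) u v w :
  heis_br u (a *: v + w) = a *: heis_br u v + heis_br u w.
Proof.
congr (_, _, _); rewrite /= ?scaler0 ?addr0 //.
rewrite [_ *: (\sum_(_ < _) _)]mulr_sumr -big_split /=.
by apply: eq_bigr => i _; rewrite !mxE /GRing.scale /=; ring.
Qed.
Fact heis_xx u : heis_br u u = 0.
Proof. by congr (_, _, _); apply: big1 => i _; rewrite subrr. Qed.
Fact heis_jacobi u v w :
  heis_br u (heis_br v w) + heis_br v (heis_br w u) + heis_br w (heis_br u v) = 0.
Proof.
have brbr x y z : heis_br x (heis_br y z) = 0.
  by congr (_, _, _); apply: big1 => i _; rewrite !mxE mulr0 mul0r subr0.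
by rewrite !brbr !addr0.
Qed.

HB.instance Definition _ := Lmodule_isLie.Build K heisenberg
  heis_linearl heis_linearr heis_xx heis_jacobi.
End Heisenberg.

(* L(3,4,1,4): the standard basis vectors e_0, .., e_3 are x, y, z, c *)
Section L3414.
Context (K : fieldType).

Definition L3414 : Type := 'rV[K]_4.
HB.instance Definition _ := Vector.on L3414.
Implicit Types u v w : L3414.

Definition L3414_br u v : L3414 :=
  (u 0 0 * v 0 1 - v 0 0 * u 0 1) *: delta_mx 0 2
  + (u 0 0 * v 0 2 - v 0 0 * u 0 2) *: delta_mx 0 3.

Fact L3414_linearl (a : K) u v w :
  L3414_br (a *: u + v) w = a *: L3414_br u w + L3414_br v w.
Proof. by apply/rowP => i; rewrite !mxE; ring. Qed.
Fact L3414_linearr (a : K) u v w :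
  L3414_br u (a *: v + w) = a *: L3414_br u v + L3414_br u w.
Proof. by apply/rowP => i; rewrite !mxE; ring. Qed.
Fact L3414_xx u : L3414_br u u = 0.
Proof. by apply/rowP => i; rewrite !mxE; ring. Qed.
Fact L3414_jacobi u v w :
  L3414_br u (L3414_br v w) + L3414_br v (L3414_br w u)
  + L3414_br w (L3414_br u v) = 0.
Proof. by apply/rowP => i; rewrite !mxE /=; ring. Qed.

HB.instance Definition _ := Lmodule_isLie.Build K L3414
  L3414_linearl L3414_linearr L3414_xx L3414_jacobi.
End L3414.

(* L(4,5,2,4): the standard basis vectors e_0, .., e_4 are x, y, z, c, d *)
Section L4524.
Context (K : fieldType).

Definition L4524 : Type := 'rV[K]_5.
HB.instance Definition _ := Vector.on L4524.
Implicit Types u v w : L4524.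

Definition L4524_br u v : L4524 :=
  (u 0 0 * v 0 1 - v 0 0 * u 0 1) *: delta_mx 0 3
  + (u 0 0 * v 0 2 - v 0 0 * u 0 2) *: delta_mx 0 4.

Fact L4524_linearl (a : K) u v w :
  L4524_br (a *: u + v) w = a *: L4524_br u w + L4524_br v w.
Proof. by apply/rowP => i; rewrite !mxE; ring. Qed.
Fact L4524_linearr (a : K) u v w :
  L4524_br u (a *: v + w) = a *: L4524_br u v + L4524_br u w.
Proof. by apply/rowP => i; rewrite !mxE; ring. Qed.
Fact L4524_xx u : L4524_br u u = 0.
Proof. by apply/rowP => i; rewrite !mxE; ring. Qed.
Fact L4524_jacobi u v w :
  L4524_br u (L4524_br v w) + L4524_br v (L4524_br w u)
  + L4524_br w (L4524_br u v) = 0.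
Proof. by apply/rowP => i; rewrite !mxE /=; ring. Qed.

HB.instance Definition _ := Lmodule_isLie.Build K L4524
  L4524_linearl L4524_linearr L4524_xx L4524_jacobi.
End L4524.

(* Main.v *)
Require Import Defs.
From HB Require Import structures.
From mathcomp Require Import all_boot all_order all_algebra.
From mathcomp Require Import boolp classical_sets ring zify.
Import GRing.Theory.
Local Open Scope ring_scope.
Set Implicit Arguments.
Unset Strict Implicit.
Unset Printing Implicit Defensive.

(** Let n = dim L, m = dim [L, L], and let J be the subspace of the exterior
    square of L spanned by the elements
    [a, b] ^ c + [b, c] ^ a + [c, a] ^ b; put r = dim J.  For a free
    presentation L = F / R the commutator F x F -> [F, F] / [R, F] only depends
    on the images in L, and induces an isomorphism of the exterior square modulo
    J with [F, F] / [R, F]: it kills J by the Jacobi identity, and its inverse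
    comes from lifting F to the central extension of L with cocycle x ^ y
    modulo J.  Hence
    dim M(L) = 'C(n, 2) - m - r ([hopf_formula]) and s(L) = m + r - n + 2
    ([s_invariantE]), so that the theorem is the classification of the
    nilpotent Lie algebras with m + r = n, a statement about J alone.

    If z is a nonzero central element of [L, L], then J maps onto the
    corresponding space of L / <z>, and the kernel contains z ^ t for every t in
    [L, L].  Iterating this gives n + 'C(m, 2) <= m + r + 2
    ([dim_jac_lower]), which excludes m >= 3; and m = 0 forces r = 0, hence n = 0.

    If m = 1, the bracket is an alternating form with values in a central line
    <z>, and L is a Heisenberg algebra plus an abelian one.  The elements of J
    have the form z ^ t; a single hyperbolic plane <x, y> only yields the t
    orthogonal to it, so that r = n - 3, while two orthogonal planes yield all t,
    so that r = n - 1 ([derived_line_classification]).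

    If m = 2, choose a nonzero central z in [L, L].  By the same count L / <z>
    has exactly one hyperbolic plane, so L = <x, y> + C with C of codimension 2
    and [x, C], [y, C], [C, C] all contained in <z>; moreover the vectors t with
    z ^ t in J form a space T of dimension at most 3 ([adapted_exists]).  Every
    nonzero bracket that involves C puts new vectors into T, and this leaves
    little room: [C, C] = 0, and if w = [x, y] is not central, then T contains C
    and one more vector, so C = <w, z> and L is filiform; if w is central, then
    T contains the centraliser of x in C, and n = 5 or 6.  A count of r removes
    n = 5 ([adapted_classification]).

    Conversely n, m and r are isomorphism invariants, and they are computed for
    the three models. *)

(** * Alternating maps and the exterior square *)

Lemma sub2K (V : zmodType) (u v t : V) : t = u + v + (t - u - v).
Proof. by rewrite -[t - u - v]addrA -opprD [RHS]addrC subrK. Qed.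

Section Alternating.
Context (K : fieldType) (V W : lmodType K) (b : V -> V -> W).
Implicit Types x y z : V.

Definition alternating_bilinear :=
  [/\ forall a x y z, b (a *: x + y) z = a *: b x z + b y z,
      forall a x y z, b x (a *: y + z) = a *: b x y + b x z
    & forall x, b x x = 0].

Context (altb : alternating_bilinear).

Lemma altDl x y z : b (x + y) z = b x z + b y z.
Proof. by have [bl _ _] := altb; rewrite -[x]scale1r bl !scale1r. Qed.
Lemma altDr x y z : b x (y + z) = b x y + b x z.
Proof. by have [_ br _] := altb; rewrite -[y]scale1r br !scale1r. Qed.
Lemma alt0l x : b 0 x = 0.
Proof. by apply: (addrI (b 0 x)); rewrite -altDl !addr0. Qed.
Lemma alt0r x : b x 0 = 0.
Proof. by apply: (addrI (b x 0)); rewrite -altDr !addr0. Qed.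
Lemma altZl a x y : b (a *: x) y = a *: b x y.
Proof. by have [bl _ _] := altb; rewrite -[a *: x]addr0 bl alt0l addr0. Qed.
Lemma altZr a x y : b x (a *: y) = a *: b x y.
Proof. by have [_ br _] := altb; rewrite -[a *: y]addr0 br alt0r addr0. Qed.
Lemma altNl x y : b (- x) y = - b x y.
Proof. by rewrite -scaleN1r altZl scaleN1r. Qed.
Lemma altNr x y : b x (- y) = - b x y.
Proof. by rewrite -scaleN1r altZr scaleN1r. Qed.
Lemma altxx x : b x x = 0.
Proof. by have [_ _] := altb. Qed.
Lemma altC x y : b x y = - b y x.
Proof.
apply/eqP; rewrite -addr_eq0; apply/eqP.
by have := altxx (x + y); rewrite altDl !altDr !altxx add0r addr0.
Qed.
Lemma alt_suml (I : finType) (u : I -> V) y :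
  b (\sum_i u i) y = \sum_i b (u i) y.
Proof. by elim/big_rec2: _ => [|i s t _ <-]; rewrite ?alt0l ?altDl. Qed.
Lemma alt_sumr (I : finType) (u : I -> V) y :
  b y (\sum_i u i) = \sum_i b y (u i).
Proof. by elim/big_rec2: _ => [|i s t _ <-]; rewrite ?alt0r ?altDr. Qed.

End Alternating.

Section ExteriorSquare.
Context (K : fieldType) (V : vectType K).
Implicit Types x y z : V.

(** The exterior square in coordinates: one coordinate for each pair of indices
    i < j of a basis, so that the dimension is 'C(n, 2) in every characteristic. *)
Definition index2 : Type := {p : 'I_(\dim {:V}) * 'I_(\dim {:V}) | (p.1 < p.2)%N}.
HB.instance Definition _ := Finite.on index2.

Definition ext2 : Type := {ffun index2 -> K^o}.
HB.instance Definition _ := Vector.on ext2.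

Definition vcoord x i : K := coord (vbasis {:V}) i x.
Definition std_vec (i : 'I_(\dim {:V})) : V := (vbasis {:V})`_i.

Definition wedge x y : ext2 :=
  [ffun p => vcoord x (val p).1 * vcoord y (val p).2
             - vcoord x (val p).2 * vcoord y (val p).1].

Lemma vcoordD x y i : vcoord (x + y) i = vcoord x i + vcoord y i.
Proof. exact: raddfD. Qed.
Lemma vcoordN x i : vcoord (- x) i = - vcoord x i.
Proof. exact: raddfN. Qed.
Lemma vcoordZ a x i : vcoord (a *: x) i = a * vcoord x i.
Proof. exact: linearZ. Qed.
Lemma vcoord0 i : vcoord 0 i = 0.
Proof. exact: raddf0. Qed.

Definition vcoordE := (vcoordD, vcoordN, vcoordZ, vcoord0).

Lemma vcoord_std i j : vcoord (std_vec i) j = (i == j)%:R.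
Proof. by rewrite /vcoord /std_vec coord_free // (basis_free (vbasisP _)). Qed.

Lemma vcoord_sum x : x = \sum_i vcoord x i *: std_vec i.
Proof. by apply: coord_vbasis; rewrite memvf. Qed.

Lemma vcoord_inj x y : vcoord x =1 vcoord y -> x = y.
Proof.
by move=> h; rewrite [x]vcoord_sum [y]vcoord_sum; apply: eq_bigr => i _; rewrite h.
Qed.

Lemma wedge_linearl a x y z : wedge (a *: x + y) z = a *: wedge x z + wedge y z.
Proof. by apply/ffunP => p; rewrite !ffunE !vcoordE /GRing.scale /=; ring. Qed.
Lemma wedge_linearr a x y z : wedge x (a *: y + z) = a *: wedge x y + wedge x z.
Proof. by apply/ffunP => p; rewrite !ffunE !vcoordE /GRing.scale /=; ring. Qed.
Lemma wedgexx x : wedge x x = 0.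
Proof. by apply/ffunP => p; rewrite !ffunE; ring. Qed.

HB.instance Definition _ x :=
  GRing.isLinear.Build K V ext2 *:%R (wedge x) (fun a => wedge_linearr a x).

Lemma dim_ext2 : \dim {:ext2} = 'C(\dim {:V}, 2).
Proof.
rewrite dimvf; have -> : dim ext2 = (#|{: index2}| * 1)%N by [].
rewrite muln1 card_sig -sum1_card /=.
rewrite (eq_bigl (fun p : 'I_(\dim {:V}) * 'I_(\dim {:V}) => true && (p.1 < p.2)%N)) //.
rewrite -(pair_big_dep predT (fun i j : 'I_(\dim {:V}) => (i < j)%N) (fun _ _ => 1%N)) /=.
rewrite (exchange_big_dep predT) //= -bin2_sum big_mkord; apply: eq_bigr => j _.
rewrite sum1_card -[RHS]card_ord.
rewrite -(card_codom (f := widen_ord (ltnW (ltn_ord j)))).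
  apply: eq_card => i; rewrite unfold_in /=; apply/idP/codomP => [h|[k ->]]; last exact: (ltn_ord k).
  by exists (Ordinal h); apply: val_inj.
by move=> a b /(congr1 val) /= e; apply: val_inj.
Qed.

(** A nonzero coordinate of [z] recovers the factor of proportionality. *)
Lemma wedge_eq0 z x : z != 0 -> wedge z x = 0 -> x \in <[z]>%VS.
Proof.
move=> z0 zx.
have [i zi] : exists i, vcoord z i != 0.
  apply/existsP; apply: contraNT z0; rewrite negb_exists => /forallP h.
  by apply/eqP/vcoord_inj => i; rewrite vcoord0; apply/eqP; rewrite -[_ == _]negbK; exact: h.
have E j : vcoord z i * vcoord x j = vcoord z j * vcoord x i.
  have [ij|ji|/val_inj -> //] := ltngtP i j.
    have /ffunP/(_ (exist _ (i, j) ij)) := zx; rewrite !ffunE /= => /eqP.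
    by rewrite subr_eq0 => /eqP.
  have /ffunP/(_ (exist _ (j, i) ji)) := zx; rewrite !ffunE /= => /eqP.
  by rewrite subr_eq0 => /eqP.
apply/vlineP; exists (vcoord x i / vcoord z i); apply: vcoord_inj => j.
by apply: (mulfI zi); rewrite vcoordZ E; field.
Qed.

Section Universal.
Context (W : lmodType K) (b : V -> V -> W).

Definition ext2_lift (A : ext2) : W :=
  \sum_p A p *: b (std_vec (val p).1) (std_vec (val p).2).

Lemma ext2_lift_linear : linear ext2_lift.
Proof.
move=> a A A'; rewrite /ext2_lift scaler_sumr -big_split /=.
by apply: eq_bigr => p _; rewrite !ffunE scalerDl scalerA.
Qed.

HB.instance Definition _ :=
  GRing.isLinear.Build K ext2 W *:%R ext2_lift ext2_lift_linear.

(** The universal property.  In the expansion of [b x y] over all pairs of basis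
    vectors the diagonal terms vanish, and the terms (i, j) and (j, i) merge into
    one coordinate of [wedge x y]. *)
Lemma ext2_lift_wedge x y :
  alternating_bilinear b -> ext2_lift (wedge x y) = b x y.
Proof.
move=> altb.
pose F (p : 'I_(\dim {:V}) * 'I_(\dim {:V})) :=
  (vcoord x p.1 * vcoord y p.2) *: b (std_vec p.1) (std_vec p.2).
have -> : b x y = \sum_p F p.
  rewrite {1}[x]vcoord_sum alt_suml // -(pair_bigA _ (fun i j => F (i, j))) /=.
  apply: eq_bigr => i _; rewrite {1}[y]vcoord_sum alt_sumr //.
  by apply: eq_bigr => j _; rewrite altZr // altZl // scalerA mulrC.
rewrite /ext2_lift (bigID (fun p : 'I_(\dim {:V}) * 'I_(\dim {:V}) => (p.1 < p.2)%N)) /=.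
rewrite [X in _ + X](bigID (fun p : 'I_(\dim {:V}) * 'I_(\dim {:V}) => (p.2 < p.1)%N)) /=.
rewrite [X in _ + (_ + X)]big1 ?addr0; last first.
  by move=> [i j] /= /andP[]; rewrite -!leqNgt => h1 h2;
    rewrite /F /= (_ : i = j) ?altxx ?scaler0 //; apply/val_inj/eqP; rewrite eqn_leq h1 h2.
rewrite [X in _ + X](eq_bigl (fun p : 'I_(\dim {:V}) * 'I_(\dim {:V}) => (p.2 < p.1)%N)); last first.
  by move=> [i j] /=; rewrite -leqNgt andbC; apply: andb_idr; apply: ltnW.
rewrite [X in _ + X](reindex (fun p : 'I_(\dim {:V}) * 'I_(\dim {:V}) => (p.2, p.1))) /=; last first.
  by exists (fun p : 'I_(\dim {:V}) * 'I_(\dim {:V}) => (p.2, p.1)) => -[].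
rewrite -big_split /=.
transitivity (\sum_(p in [pred p : 'I_(\dim {:V}) * 'I_(\dim {:V}) | (p.1 < p.2)%N])
  (F p + F (p.2, p.1))); last by apply: eq_bigl.
rewrite [RHS]big_sub.
apply: eq_bigr => p _; rewrite ffunE /F /= scalerBl; congr (_ + _).
by rewrite [in RHS]altC // scalerN mulrC.
Qed.

End Universal.

Lemma alt_wedge : alternating_bilinear wedge.
Proof. by split; [exact: wedge_linearl | exact: wedge_linearr | exact: wedgexx]. Qed.

(** The basis vectors of the exterior square are wedges, hence wedges span. *)
Lemma ext2_lift_wedge_id : ext2_lift wedge =1 id.
Proof.
move=> A; rewrite /ext2_lift; apply/ffunP => q; rewrite sum_ffunE (bigD1 q) //= big1.
  rewrite addr0 !ffunE !vcoord_std !eqxx /= [X in _ - X](_ : _ = 0).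
    by rewrite subr0 mulr1 /GRing.scale /= mulr1.
  by case: q => -[i j] /= ij; case: eqVneq ij => [->|]; rewrite ?ltnn ?mul0r.
move=> [[i j] ij] pq; case: q pq => -[k l] kl; rewrite -val_eqE /= => pq.
rewrite !ffunE !vcoord_std /=.
have E1 : ((i == k)%:R * (j == l)%:R : K) = 0.
  case: (eqVneq i k) => [E|_]; last by rewrite mul0r.
  case: (eqVneq j l) => [E'|_]; last by rewrite mulr0.
  by rewrite E E' eqxx in pq.
have E2 : ((i == l)%:R * (j == k)%:R : K) = 0.
  case: (eqVneq i l) => [E|_]; last by rewrite mul0r.
  case: (eqVneq j k) => [E'|_]; last by rewrite mulr0.
  by move: ij; rewrite /= E E' => /(ltn_trans kl); rewrite ltnn.
by rewrite E1 E2 subr0 scaler0.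
Qed.

Lemma ext2_ind (P : ext2 -> Prop) :
  P 0 -> (forall a x y A, P A -> P (a *: wedge x y + A)) -> forall A, P A.
Proof.
move=> P0 PD A; rewrite -[A]ext2_lift_wedge_id /ext2_lift.
by elim/big_rec: _ => // p s _; apply: PD.
Qed.

End ExteriorSquare.

Section Wedge.
Context (K : fieldType) (V : vectType K).
Implicit Types x y z : V.
Definition wedgeDr := altDr (@alt_wedge K V).
Definition wedgeZl := altZl (@alt_wedge K V).
Definition wedgeZr := altZr (@alt_wedge K V).
Definition wedgeNl := altNl (@alt_wedge K V).
Definition wedgeNr := altNr (@alt_wedge K V).
Definition wedge0l := alt0l (@alt_wedge K V).
Definition wedge0r := alt0r (@alt_wedge K V).
Definition wedgeC := altC (@alt_wedge K V).

Definition wedgeL x : 'Hom(V, ext2 V) := linfun (wedge x).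
Lemma wedgeLE x y : wedgeL x y = wedge x y.
Proof. by rewrite lfunE. Qed.

(** By [wedge_eq0] only the line of [z] is lost. *)
Lemma dim_wedgeL z (T : {vspace V}) :
  z != 0 -> (\dim T <= (\dim (wedgeL z @: T)).+1)%N.
Proof.
move=> z0; rewrite -(limg_ker_dim (wedgeL z) T) -addn1 addnC leq_add2l.
apply: (@leq_trans (\dim <[z]>)); last by rewrite dim_vline z0.
apply: dimvS; apply/subvP => t; rewrite memv_cap memv_ker wedgeLE => /andP[_ /eqP].
exact: wedge_eq0.
Qed.

Lemma dim_wedgeL_eq z (T : {vspace V}) :
  z != 0 -> z \in T -> (\dim T = (\dim (wedgeL z @: T)).+1)%N.
Proof.
move=> z0 zT; apply/eqP; rewrite eqn_leq dim_wedgeL //=.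
rewrite -(limg_ker_dim (wedgeL z) T) -add1n leq_add2r.
apply: (@leq_trans (\dim <[z]>)); first by rewrite dim_vline z0.
by apply: dimvS; rewrite -memvE memv_cap zT memv_ker wedgeLE wedgexx eqxx.
Qed.

End Wedge.

Section ExtMap.
Context (K : fieldType) (V W : vectType K) (f : {linear V -> W}).

Definition ext2_map : 'Hom(ext2 V, ext2 W) :=
  linfun (ext2_lift (fun x y => wedge (f x) (f y))).

Lemma ext2_map_wedge x y : ext2_map (wedge x y) = wedge (f x) (f y).
Proof.
rewrite lfunE /= ext2_lift_wedge //; split=> *.
- by rewrite linearP wedge_linearl.
- by rewrite linearP wedge_linearr.
- by rewrite wedgexx.
Qed.
End ExtMap.

(** * The derived algebra and the 2-boundaries of a Lie algebra *)

Section LieBasics.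
Context (K : fieldType) (L : lieAlgType K).
Lemma alt_lie : alternating_bilinear (@lie K L).
Proof. by split; [exact: lie_linearl | exact: lie_linearr | exact: liexx]. Qed.
Definition lieDl := altDl alt_lie.
Definition lieDr := altDr alt_lie.
Definition lieZl := altZl alt_lie.
Definition lieZr := altZr alt_lie.
Definition lieNl := altNl alt_lie.
Definition lieNr := altNr alt_lie.
Definition lie0l := alt0l alt_lie.
Definition lie0r := alt0r alt_lie.
Definition lieC := altC alt_lie.
End LieBasics.

Section FinLie.
Context (K : fieldType) (L : finLieAlgType K).
Implicit Types x y z a b c : L.

Definition bracket2 : 'Hom(ext2 L, L) := linfun (ext2_lift (@lie K L)).
Definition derived : {vspace L} := limg bracket2.

Lemma bracket2_wedge x y : bracket2 (wedge x y) = lie x y.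
Proof. by rewrite lfunE /= ext2_lift_wedge //; exact: alt_lie. Qed.

Lemma mem_derived x y : lie x y \in derived.
Proof. by rewrite -bracket2_wedge memv_img ?memvf. Qed.

Lemma derived_sub (U : {vspace L}) :
  (forall x y, lie x y \in U) -> (derived <= U)%VS.
Proof.
move=> h; apply/subvP => _ /memv_imgP[A _ ->].
elim/ext2_ind: A => [|a x y A IH]; first by rewrite linear0 mem0v.
by rewrite linearP /= bracket2_wedge memvD ?memvZ ?h.
Qed.

(** Up to sign, the Chevalley-Eilenberg boundary of a ^ b ^ c. *)
Definition jac a b c : ext2 L :=
  wedge (lie a b) c + wedge (lie b c) a + wedge (lie c a) b.

(** The space J of 2-boundaries.  Triples of basis vectors suffice because [jac]
    is trilinear, see [mem_jac]. *)
Definition jac_space : {vspace ext2 L} :=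
  (\sum_(p : 'I_(\dim {:L}) * 'I_(\dim {:L}) * 'I_(\dim {:L}))
     <[jac (std_vec p.1.1) (std_vec p.1.2) (std_vec p.2)]>)%VS.

Lemma jac_cyc a b c : jac a b c = jac b c a.
Proof. by rewrite /jac -addrA addrC. Qed.

Lemma jac_linear a b : linear (jac a b).
Proof.
move=> k c d; rewrite /jac lie_linearr lie_linearl !wedge_linearl wedge_linearr.
by rewrite !scalerDr [X in X + _]addrACA [LHS]addrACA.
Qed.

Lemma jac_suml (I : finType) (t : I -> K) (u : I -> L) a b :
  jac a b (\sum_i t i *: u i) = \sum_i t i *: jac a b (u i).
Proof.
have h0 : jac a b 0 = 0 by rewrite /jac lie0l lie0r !wedge0l wedge0r !addr0.
by elim/big_rec2: _ => [|i x y _ <-]; rewrite ?h0 ?jac_linear.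
Qed.

Lemma mem_jac a b c : jac a b c \in jac_space.
Proof.
rewrite [c]vcoord_sum jac_suml memv_suml // => k _; rewrite memvZ //.
rewrite jac_cyc jac_cyc [b]vcoord_sum jac_suml memv_suml // => j _; rewrite memvZ //.
rewrite jac_cyc jac_cyc [a]vcoord_sum jac_suml memv_suml // => i _; rewrite memvZ //.
by apply: (sumv_sup (j, k, i)); rewrite // -memvE memv_line.
Qed.

Lemma jac_space_sub (U : {vspace ext2 L}) :
  (forall a b c, jac a b c \in U) -> (jac_space <= U)%VS.
Proof. by move=> h; apply/subv_sumP => p _; rewrite -memvE h. Qed.

Lemma jac_space_bracket : (jac_space <= lker bracket2)%VS.
Proof.
apply: jac_space_sub => a b c; rewrite memv_ker /jac !linearD /= !bracket2_wedge.
rewrite lieC [lie (lie b c) a]lieC [lie (lie c a) b]lieC -!opprD oppr_eq0.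
by rewrite -addrA addrC lie_jacobi.
Qed.

End FinLie.

(** * Hopf's formula *)

Section CentralExtension.
Context (K : fieldType) (L : lieAlgType K) (W : lmodType K) (f : L -> L -> W).

(** In this form the second condition says exactly that the bracket
    [(lie u.1 v.1, f u.1 v.1)] on the product satisfies the Jacobi identity. *)
Definition cocycle := alternating_bilinear f /\
  forall x y z, f x (lie y z) + f y (lie z x) + f z (lie x y) = 0.

(** The proof that [f] is a cocycle is an argument of the type, since the Lie
    structure declared on the type depends on it. *)
Definition central_ext (_ : cocycle) : Type := (L * W)%type.

Context (fP : cocycle).
Let E := central_ext fP.
HB.instance Definition _ := GRing.Lmodule.on E.
Implicit Types u v w : E.

Definition cext_lie u v : E := (lie u.1 v.1, f u.1 v.1).

Fact cext_linearl (a : K) u v w :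
  cext_lie (a *: u + v) w = a *: cext_lie u w + cext_lie v w.
Proof. by case: fP => -[fl _ _] _; rewrite /cext_lie /= lie_linearl fl. Qed.
Fact cext_linearr (a : K) u v w :
  cext_lie u (a *: v + w) = a *: cext_lie u v + cext_lie u w.
Proof. by case: fP => -[_ fr _] _; rewrite /cext_lie /= lie_linearr fr. Qed.
Fact cext_xx u : cext_lie u u = 0.
Proof. by case: fP => -[_ _ fxx] _; rewrite /cext_lie liexx fxx. Qed.
Fact cext_jacobi u v w :
  cext_lie u (cext_lie v w) + cext_lie v (cext_lie w u) + cext_lie w (cext_lie u v) = 0.
Proof. by congr (_, _); [apply: lie_jacobi | case: fP => _ /=; apply]. Qed.

HB.instance Definition _ := Lmodule_isLie.Build K E
  cext_linearl cext_linearr cext_xx cext_jacobi.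
End CentralExtension.

Section LinSpan.
Context (K : fieldType) (V : lmodType K) (S : set V).

Lemma lin_span_in x : S x -> lin_span S x.
Proof.
move=> Sx; exists 1%N, (fun=> 1), (fun=> x); split=> //.
by rewrite big_ord1 scale1r.
Qed.

Lemma lin_spanP a x y : lin_span S x -> lin_span S y -> lin_span S (a *: x + y).
Proof.
move=> Sx Sy.
have := @lin_span_comb K V S 2 (fun i => if i == ord0 then a else 1)
  (fun i => if i == ord0 then x else y).
rewrite !big_ord_recl big_ord0 addr0 /= scale1r; apply=> i.
by case: ifP.
Qed.

Lemma lin_span0 : lin_span S 0.
Proof. by exists 0%N, (fun=> 0), (fun=> 0); split; [case | rewrite big_ord0]. Qed.

Lemma lin_spanD x y : lin_span S x -> lin_span S y -> lin_span S (x + y).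
Proof. by move=> Sx Sy; rewrite -[x]scale1r; apply: lin_spanP. Qed.

Lemma lin_spanZ a x : lin_span S x -> lin_span S (a *: x).
Proof. by move=> Sx; rewrite -[a *: x]addr0; apply: lin_spanP => //; apply: lin_span0. Qed.

Lemma lin_spanN x : lin_span S x -> lin_span S (- x).
Proof. by move=> Sx; rewrite -scaleN1r; apply: lin_spanZ. Qed.

Lemma lin_span_ind (P : V -> Prop) :
  P 0 -> (forall a x y, S x -> P y -> P (a *: x + y)) ->
  forall x, lin_span S x -> P x.
Proof.
move=> P0 PD _ [n [a [s [Ss ->]]]].
by elim/big_rec: _ => // i y _; apply: PD.
Qed.
End LinSpan.

Lemma jac_space_ind (K : fieldType) (L : finLieAlgType K) (P : ext2 L -> Prop) :
  P 0 -> (forall k a b c A, P A -> P (k *: jac a b c + A)) ->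
  forall A, A \in jac_space L -> P A.
Proof.
move=> P0 PD A /memv_sumP[v vin ->]; elim/big_rec: _ => // p B _ PB.
by have /vlineP[k ->] := vin p isT; apply: PD.
Qed.

Section Hopf.
Context (K : fieldType) (L : finLieAlgType K) (P : free_presentation L).
Local Notation F := (fp_free P).
Local Notation pi := (@fp_proj K L P).
Local Notation J := (jac_space L).

HB.instance Definition _ := GRing.isLinear.Build K F L *:%R pi (proj1 (fp_projM P)).

Lemma fp_proj_lie u v : pi (lie u v) = lie (pi u) (pi v).
Proof. by have [_ ->] := fp_projM P. Qed.

Lemma fp_section : exists s : {linear L -> F}, cancel s pi.
Proof.
have /choice[e he] (i : 'I_(\dim {:L})) : exists x, pi x = std_vec i by exact: fp_projS.
pose s x := \sum_i vcoord x i *: e i.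
have sl : linear s.
  move=> a x y; rewrite /s scaler_sumr -big_split; apply: eq_bigr => i _.
  by rewrite !vcoordE scalerDl scalerA.
pose s' : {linear L -> F} := HB.pack s (GRing.isLinear.Build K L F *:%R s sl).
exists s' => x; rewrite [RHS]vcoord_sum /= /s linear_sum; apply: eq_bigr => i _.
by rewrite linearZ /= he.
Qed.

(** The map from F to the central extension defined by [f] that lifts the
    projection on the generators: its first component is the projection, by
    uniqueness, and its second component is the required [phi]. *)
Lemma fp_lift_ext (W : lmodType K) (f : L -> L -> W) (fP : cocycle f) :
  exists phi : {linear F -> W}, forall u v, phi (lie u v) = f (pi u) (pi v).
Proof.
pose E := central_ext fP.
have [h [[[hl hb] hg] _]] := @fp_freeP K L P E (fun x => (pi (fp_inc x), 0) : E).
have h1 : (fun u => (h u).1) = pi.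
  have [k [_ ku]] := @fp_freeP K L P L (fun x => pi (fp_inc x)).
  rewrite -(ku pi); last by split=> //; exact: fp_projM.
  symmetry; apply: ku; split; last by move=> x; rewrite hg.
  by split=> [a u v|u v]; rewrite ?hl ?hb.
have pl : linear (fun u => (h u).2) by move=> a u v; rewrite hl.
pose phi : {linear F -> W} := HB.pack (fun u => (h u).2)
  (GRing.isLinear.Build K F W *:%R (fun u => (h u).2) pl).
by exists phi => u v /=; rewrite hb /= -h1.
Qed.

Local Notation RF := (lie_comm (@fp_rel K L P) [set: F]%classic).

Lemma RF_rel u : RF u -> pi u = 0.
Proof.
elim/lin_span_ind => [|a _ y [x [z [xR _ ->]]] h]; first by rewrite linear0.
by rewrite linearP /= h addr0 fp_proj_lie xR lie0l scaler0.
Qed.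

(** With a linear section [s] of the projection, x ^ y |-> [s x, s y] induces
    [sig] from the exterior square modulo J to [F, F] / [R, F].  The cocycle
    (x, y) |-> x ^ y modulo J produces [phi] in the opposite direction, and
    [phi] inverts [sig] modulo J.  Both are compatible with the maps to L, so that
    M(L), the kernel of [F, F] / [R, F] -> L, corresponds to the kernel of
    x ^ y |-> [x, y] modulo J. *)
Theorem hopf_formula :
  (schur_dim P + \dim (derived L) + \dim J = 'C(\dim {:L}, 2))%N.
Proof.
have [s sK] := fp_section.
pose sig : {linear ext2 L -> F} := ext2_lift (fun x y => lie (s x) (s y)).
have altS : alternating_bilinear (fun x y => lie (s x) (s y)).
  by split=> [a x y z|a x y z|x]; rewrite ?linearP ?lie_linearl ?lie_linearr ?liexx.
have sigE x y : sig (wedge x y) = lie (s x) (s y) by exact: ext2_lift_wedge.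
have RFlie u v : pi u = 0 -> RF (lie u v) by move=> h; apply: lin_span_in; exists u, v.
have RFsig u v : RF (lie u v - sig (wedge (pi u) (pi v))).
  rewrite sigE -[u in lie u v](subrK (s (pi u))) lieDl -addrA; apply: lin_spanD.
    by apply: RFlie; rewrite linearB /= sK subrr.
  rewrite -lieNr -lieDr lieC; apply: lin_spanN; apply: RFlie.
  by rewrite linearB /= sK subrr.
(* The Jacobi identity in F makes [sig] vanish on J modulo [R, F]. *)
have RFJ A : A \in J -> RF (sig A).
  elim/jac_space_ind: A / => [|k a b c A IH]; first by rewrite linear0; apply: lin_span0.
  rewrite linearP; apply: lin_spanP => //; rewrite /jac !linearD /=.
  have step x y z : RF (lie (lie (s x) (s y)) (s z) - sig (wedge (lie x y) z)).
    by have := RFsig (lie (s x) (s y)) (s z); rewrite fp_proj_lie !sK.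
  have := lin_spanN (lin_spanD (lin_spanD (step a b c) (step b c a)) (step c a b)).
  have jE : lie (lie (s a) (s b)) (s c) + lie (lie (s b) (s c)) (s a)
      + lie (lie (s c) (s a)) (s b) = 0.
    rewrite lieC [lie (lie (s b) _) _]lieC [lie (lie (s c) _) _]lieC -!opprD.
    by apply/eqP; rewrite oppr_eq0 -addrA addrC lie_jacobi.
  congr (RF _); rewrite (addrACA (lie _ _)) -opprD.
  by rewrite (addrACA (lie _ _ + lie _ _)) -opprD jE add0r opprK.
(* The quotient by J is encoded as the projection along J: A - projv J A. *)
have [phi phiE] : exists phi : {linear F -> ext2 L}, forall u v,
    phi (lie u v) = wedge (pi u) (pi v) - projv J (wedge (pi u) (pi v)).
  apply: (@fp_lift_ext _ (fun x y => wedge x y - projv J (wedge x y))); split.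
    split=> [a x y z|a x y z|x].
    - by rewrite wedge_linearl linearP /= scalerBr opprD addrACA.
    - by rewrite wedge_linearr linearP /= scalerBr opprD addrACA.
    - by rewrite wedgexx linear0 subrr.
  move=> x y z; rewrite (addrACA (wedge x _)) -opprD (addrACA (wedge x _ + _)) -opprD.
  rewrite -!linearD /=.
  have jE : wedge x (lie y z) + wedge y (lie z x) + wedge z (lie x y) = - jac x y z.
    rewrite /jac wedgeC [wedge y _]wedgeC [wedge z _]wedgeC -!opprD; congr (- _).
    by rewrite addrC addrA.
  by rewrite jE projv_id ?subrr // memvN mem_jac.
have phiRF u : RF u -> phi u = 0.
  elim/lin_span_ind => [|a _ y [x [z [xR _ ->]]] h]; first by rewrite linear0.
  by rewrite linearP /= h addr0 phiE xR wedge0l linear0 subrr scaler0.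
have phisig A : phi (sig A) = A - projv J A.
  elim/ext2_ind: A => [|a x y A IH].
    by rewrite [sig 0]linear0 [phi 0]linear0 [projv J 0]linear0 subrr.
  rewrite [sig _]linearP [phi _]linearP [projv J _]linearP /=.
  by rewrite IH sigE phiE !sK scalerBr opprD addrACA.
have pisig A : pi (sig A) = bracket2 L A.
  elim/ext2_ind: A => [|a x y A IH].
    by rewrite [sig 0]linear0 [pi 0]linear0 linear0.
  rewrite [sig _]linearP [pi _]linearP [bracket2 L _]linearP /=.
  by rewrite IH sigE fp_proj_lie !sK bracket2_wedge.
(* The basis of a complement of J in the kernel of x ^ y |-> [x, y] is mapped by
   [sig] to a basis of M(L). *)
pose N := (lker (bracket2 L) :\: J)%VS.
have dN : (\dim J + \dim N = \dim (lker (bracket2 L)))%N.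
  rewrite -(dimv_cap_compl (lker (bracket2 L)) J); congr (\dim _ + _)%N.
  by symmetry; apply/capv_idPr; exact: jac_space_bracket.
have -> : schur_dim P = \dim N.
  apply: (dim_modE (b := fun i => sig (vbasis N)`_i)); split.
  - move=> i; split.
      rewrite /fp_rel /= pisig; apply/eqP; rewrite -memv_ker.
      by apply: (subvP (diffvSl _ J)); apply: vbasis_mem; rewrite mem_nth ?size_tuple.
    elim/ext2_ind: ((vbasis N)`_i) => [|a x y A IH].
      by rewrite linear0; apply: lin_span0.
    rewrite linearP /= sigE; apply: lin_spanP => //.
    by apply: lin_span_in; exists (s x), (s y).
  - move=> a; rewrite -[X in lin_span _ X](_ : sig (\sum_i a i *: (vbasis N)`_i) = _); last first.
      by rewrite linear_sum; apply: eq_bigr => i _; rewrite linearZ.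
    move=> /phiRF; rewrite phisig => /eqP; rewrite subr_eq0 => /eqP e.
    set w := \sum_i _ in e.
    have : w \in (N :&: J)%VS.
      rewrite memv_cap {2}e memv_proj andbT; apply: memv_suml => i _; apply: memvZ.
      by apply: vbasis_mem; rewrite mem_nth ?size_tuple.
    by rewrite capv_diff memv0 => /eqP; apply/freeP; exact: basis_free (vbasisP N).
  - move=> u [uR uF].
    have [A RA] : exists A, RF (u - sig A).
      elim/lin_span_ind: uF {uR} => [|a _ y [x [z [_ _ ->]]] [A h]].
        by exists 0; rewrite linear0 subrr; apply: lin_span0.
      exists (a *: wedge (pi x) (pi z) + A); rewrite linearP /= opprD addrACA -scalerBr.
      by apply: lin_spanP => //; exact: RFsig.
    have : A \in lker (bracket2 L).
      by rewrite memv_ker -pisig; have := RF_rel RA; rewrite linearB /= uR sub0r => /eqP; rewrite oppr_eq0.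
    rewrite -{1}(addv_diff_cap (lker (bracket2 L)) J) => /memv_addP[w wN [j]]; rewrite memv_cap => /andP[_ jJ] Aw.
    exists (fun i => coord (vbasis N) i w).
    have -> : \sum_i coord (vbasis N) i w *: sig (vbasis N)`_i = sig w.
      rewrite {2}(coord_vbasis wN) linear_sum; apply: eq_bigr => i _.
      by rewrite linearZ.
    have -> : u - sig w = (u - sig A) + sig j by rewrite Aw linearD opprD addrA subrK.
    by apply: lin_spanD => //; apply: RFJ.
rewrite -dim_ext2 -(limg_ker_dim (bracket2 L) {:ext2 L}%VS) capfv -dN.
by rewrite -/(derived L) addnAC [(_ + \dim J)%N]addnC.
Qed.
End Hopf.

(** * Central quotients and a lower bound for J *)

HB.instance Definition _ (K : fieldType) (L : lieAlgType K) (x : L) :=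
  GRing.isLinear.Build K L L *:%R (lie x) (fun a => @lie_linearr K L a x).

Definition central (K : fieldType) (L : lieAlgType K) (z : L) :=
  forall x, lie z x = 0.

Lemma centralr (K : fieldType) (L : lieAlgType K) (z x : L) : central z -> lie x z = 0.
Proof. by move=> cz; rewrite lieC cz oppr0. Qed.

Section CentralQuotient.
Context (K : fieldType) (L : finLieAlgType K) (z : L).

(** The quotient by <z>, carried by a complement of <z>: this makes it a
    finite-dimensional vector space by construction. *)
Definition central_quotient (_ : central z) : Type := subvs_of (<[z]>^C)%VS.

Context (zc : central z).
Let Q := central_quotient zc.
HB.instance Definition _ := Vector.on Q.

Definition quo_proj (x : L) : Q := vsproj (<[z]>^C)%VS (x - projv <[z]>%VS x).
Definition quo_rep (u : Q) : L := vsval u.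

Fact quo_proj_linear : linear quo_proj.
Proof. by move=> a x y; rewrite /quo_proj linearP opprD addrACA -scalerBr linearP. Qed.
HB.instance Definition _ := GRing.isLinear.Build K L Q *:%R quo_proj quo_proj_linear.
Fact quo_rep_linear : linear quo_rep. Proof. by []. Qed.
HB.instance Definition _ := GRing.isLinear.Build K Q L *:%R quo_rep quo_rep_linear.

Lemma quo_repK : cancel quo_rep quo_proj.
Proof.
move=> u; rewrite /quo_proj (_ : projv _ _ = 0) ?subr0 ?vsvalK //.
by apply/eqP; rewrite -memv_ker lker_proj subvsP.
Qed.

Lemma quo_proj_eq0 x : quo_proj x = 0 <-> x \in <[z]>%VS.
Proof.
split=> [|xz]; last by rewrite /quo_proj projv_id // subrr linear0.
move/congr_subvs; rewrite vsprojK ?memv_projC // => /eqP.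
by rewrite subr_eq0 => /eqP ->; exact: memv_proj.
Qed.

Lemma quo_projK x : quo_rep (quo_proj x) - x \in <[z]>%VS.
Proof. by apply/quo_proj_eq0; rewrite linearB /= quo_repK subrr. Qed.

Definition quo_lie (u v : Q) : Q := quo_proj (lie (quo_rep u) (quo_rep v)).

Lemma quo_proj_lie x y : quo_proj (lie x y) = quo_lie (quo_proj x) (quo_proj y).
Proof.
rewrite /quo_lie; have /vlineP[a ea] := quo_projK x; have /vlineP[b eb] := quo_projK y.
rewrite -[quo_rep (quo_proj x)](subrK x) -[quo_rep (quo_proj y)](subrK y) ea eb.
by rewrite lieDl !lieDr !lieZl !lieZr !zc (centralr _ zc) !scaler0 !add0r.
Qed.

Fact quo_linearl (a : K) u v w :
  quo_lie (a *: u + v) w = a *: quo_lie u w + quo_lie v w.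
Proof. by rewrite /quo_lie linearP lie_linearl linearP. Qed.
Fact quo_linearr (a : K) u v w :
  quo_lie u (a *: v + w) = a *: quo_lie u v + quo_lie u w.
Proof. by rewrite /quo_lie [quo_rep (_ + _)]linearP /= lie_linearr linearP. Qed.
Fact quo_xx u : quo_lie u u = 0.
Proof. by rewrite /quo_lie liexx linear0. Qed.
Fact quo_jacobi u v w :
  quo_lie u (quo_lie v w) + quo_lie v (quo_lie w u) + quo_lie w (quo_lie u v) = 0.
Proof.
rewrite -[u]quo_repK -[v]quo_repK -[w]quo_repK -!quo_proj_lie -!linearD /=.
by rewrite lie_jacobi linear0.
Qed.
HB.instance Definition _ := Lmodule_isLie.Build K Q
  quo_linearl quo_linearr quo_xx quo_jacobi.

End CentralQuotient.

Lemma central_quotient_exists (K : fieldType) (L : finLieAlgType K) (z : L) :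
  central z -> exists (Q : finLieAlgType K) (q : {linear L -> Q}),
    [/\ {morph q : x y / lie x y}, forall u, exists x, q x = u
      & forall x, q x = 0 <-> x \in <[z]>%VS].
Proof.
move=> zc; exists (central_quotient zc), (quo_proj zc); split.
- exact: quo_proj_lie.
- by move=> u; exists (quo_rep u); exact: quo_repK.
- exact: quo_proj_eq0.
Qed.

Section Nilpotent.
Context (K : fieldType) (L : finLieAlgType K).

Lemma lower_central_derived k x : @lower_central K L k.+1 x -> x \in derived L.
Proof.
elim/lin_span_ind => [|a _ y [u [v [_ _ ->]]] h]; first exact: mem0v.
by rewrite memvD // memvZ // mem_derived.
Qed.

(** Any element of the last nonzero term of the lower central series works; that
    term lies in the derived algebra as soon as L is not abelian. *)
Lemma nilpotent_center : nilpotent_lie L -> derived L != 0%VS ->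
  exists z, [/\ z != 0, z \in derived L & central z].
Proof.
move=> [k kP] D0.
have D1 : (forall x y : L, lie x y = 0) -> False.
  move=> h; case/eqP: D0; apply/eqP; rewrite -subv0.
  by apply: derived_sub => x y; rewrite h mem0v.
elim: k kP => [|k IH] kP.
  by case: D1 => x y; apply: (kP _ Logic.I).
have [|/existsNP[z /not_implyP[zk /eqP z0]]] := pselect (forall x, @lower_central K L k x -> x = 0).
  by move=> h; apply: IH => x /h.
have zc x : lie x z = 0.
  by apply: kP; apply: lin_span_in; exists x, z.
exists z; split=> //; last by move=> x; rewrite lieC zc oppr0.
case: k {IH} kP zk => [|k] kP zk; last exact: lower_central_derived zk.
by case: D1 => x y; apply: kP; apply: lin_span_in; exists x, y.
Qed.
End Nilpotent.

Section QuotientBounds.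
Context (K : fieldType) (L Q : finLieAlgType K) (z : L) (q : {linear L -> Q}).
Context (z0 : z != 0) (qM : {morph q : x y / lie x y}).
Context (qS : forall u, exists x, q x = u).
Context (qK : forall x, q x = 0 <-> x \in <[z]>%VS).

Lemma nilpotent_quotient : nilpotent_lie L -> nilpotent_lie Q.
Proof.
move=> [k kP]; exists k => u uk.
suff [x xk <-] : exists2 x, @lower_central K L k x & q x = u.
  by rewrite (kP _ xk) linear0.
elim: k {kP} u uk => [|k IH] u; first by have [x <-] := qS u; exists x.
elim/lin_span_ind => [|a _ y [v [w [_ /IH[x xk <-] ->]]] [t tk <-]].
  by exists 0; rewrite ?linear0 //; apply: lin_span0.
have [s <-] := qS v; exists (a *: lie s x + t); last by rewrite linearP /= qM.
by apply: lin_spanP => //; apply: lin_span_in; exists s, x.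
Qed.

Let ql : 'Hom(L, Q) := linfun q.
Let qlE x : ql x = q x. Proof. by rewrite lfunE. Qed.

Lemma lker_quotient : lker ql = <[z]>%VS.
Proof.
by apply/vspaceP => x; rewrite memv_ker qlE; apply/eqP/idP => /qK.
Qed.

Lemma dim_quotient : \dim {:L} = (\dim {:Q}).+1.
Proof.
rewrite -(limg_ker_dim ql) capfv lker_quotient dim_vline z0 add1n; congr (\dim _).+1.
apply/vspaceP => u; rewrite memvf; have [x <-] := qS u.
by rewrite -qlE memv_img ?memvf.
Qed.

Lemma derived_quotient : (ql @: derived L)%VS = derived Q.
Proof.
apply/eqP; rewrite eqEsubv; apply/andP; split.
  apply/subvP => _ /memv_imgP[x xL ->]; rewrite memv_preim.
  apply: (subvP _ _ xL); apply: derived_sub => a b.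
  by rewrite -memv_preim qlE qM mem_derived.
apply: derived_sub => u v; have [x <-] := qS u; have [y <-] := qS v.
by rewrite -qM -qlE memv_img // mem_derived.
Qed.

Lemma dim_derived_quotient :
  z \in derived L -> \dim (derived L) = (\dim (derived Q)).+1.
Proof.
move=> zD; rewrite -(limg_ker_dim ql) derived_quotient lker_quotient.
by rewrite (capv_idPr _) -?memvE // dim_vline z0.
Qed.

Lemma ext2_map_jac a b c : ext2_map q (jac a b c) = jac (q a) (q b) (q c).
Proof. by rewrite /jac !linearD /= !ext2_map_wedge !qM. Qed.

Lemma jac_quotient : (ext2_map q @: jac_space L)%VS = jac_space Q.
Proof.
apply/eqP; rewrite eqEsubv; apply/andP; split.
  apply/subvP => _ /memv_imgP[x xL ->]; rewrite memv_preim.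
  apply: (subvP _ _ xL); apply: jac_space_sub => a b c.
  by rewrite -memv_preim ext2_map_jac mem_jac.
apply: jac_space_sub => u v w.
have [x <-] := qS u; have [y <-] := qS v; have [t <-] := qS w.
by rewrite -ext2_map_jac memv_img // mem_jac.
Qed.

(** J maps onto the space J of the quotient, and all z ^ t lie in the kernel; the
    vectors t give a space of wedges of dimension at least dim T - 1. *)
Lemma dim_jac_quotient (T : {vspace L}) :
  (forall t, t \in T -> wedge z t \in jac_space L) ->
  (\dim T + \dim (jac_space Q) <= (\dim (jac_space L)).+1)%N.
Proof.
move=> TJ; rewrite -(limg_ker_dim (ext2_map q) (jac_space L)) jac_quotient -addSn.
rewrite leq_add2r; apply: leq_trans (dim_wedgeL T z0) _; rewrite ltnS; apply: dimvS.
apply/subvP => _ /memv_imgP[t tT ->]; rewrite wedgeLE memv_cap TJ //= memv_ker.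
by rewrite ext2_map_wedge (_ : q z = 0) ?wedge0l //; apply/qK; exact: memv_line.
Qed.

End QuotientBounds.

Section LowerBound.
Context (K : fieldType).

(** For central z two of the three terms of [jac z a b] vanish. *)
Lemma central_wedge_derived (L : finLieAlgType K) (z t : L) :
  central z -> t \in derived L -> wedge z t \in jac_space L.
Proof.
move=> zc tD; rewrite -wedgeLE memv_preim; apply: (subvP _ _ tD).
apply: derived_sub => a b; rewrite -memv_preim wedgeLE.
have := mem_jac z a b; rewrite /jac zc (centralr _ zc) !wedge0l add0r addr0.
by rewrite wedgeC memvN.
Qed.

Definition ad (L : finLieAlgType K) (x : L) : 'Hom(L, L) := linfun (lie x).
Lemma adE (L : finLieAlgType K) (x y : L) : ad x y = lie x y.
Proof. by rewrite lfunE. Qed.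

(** For one-dimensional [L, L], the orthogonal of the plane <x, y> with respect
    to the alternating form given by the bracket. *)
Definition perp (L : finLieAlgType K) (x y : L) : {vspace L} :=
  (lker (ad x) :&: lker (ad y))%VS.

Lemma perpP (L : finLieAlgType K) (x y t : L) :
  reflect (lie x t = 0 /\ lie y t = 0) (t \in perp x y).
Proof.
rewrite memv_cap !memv_ker !adE.
by apply: (iffP andP) => -[] /eqP ? /eqP ?; split.
Qed.

Lemma dim_perp (L : finLieAlgType K) (x y : L) :
  (\dim (derived L) <= 1)%N -> (\dim {:L} <= \dim (perp x y) + 2)%N.
Proof.
move=> D1.
have kd (u : L) : (\dim {:L} <= (\dim (lker (ad u))).+1)%N.
  rewrite -(limg_ker_dim (ad u) {:L}) capfv -addn1 leq_add2l.
  apply: leq_trans D1; apply: dimvS; apply/subvP => _ /memv_imgP[t _ ->].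
  by rewrite adE mem_derived.
have := kd x; have := kd y; rewrite /perp.
have := dimv_sum_cap (lker (ad x)) (lker (ad y)).
have := dimvS (subvf (lker (ad x) + lker (ad y))%VS).
lia.
Qed.

Lemma jac_perp (L : finLieAlgType K) (x y t : L) :
  t \in perp x y -> jac x y t = wedge (lie x y) t.
Proof.
move=> /perpP[xt yt]; rewrite /jac yt [lie t x]lieC xt oppr0 !wedge0l !addr0 //.
Qed.

Lemma derived_neq0 (L : finLieAlgType K) :
  derived L != 0%VS -> exists x y : L, lie x y != 0.
Proof.
move=> D0; apply/not_existsP => h; case/eqP: D0; apply/eqP; rewrite -subv0.
apply: derived_sub => x y; rewrite memv0; apply/negPn/negP => xy.
by apply: (h x); exists y.
Qed.

(** If [x, y] = w is nonzero, then J contains w ^ t for all t orthogonal to x and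
    y, a space of codimension at most 2. *)
Lemma dim_jac_derived1 (L : finLieAlgType K) :
  \dim (derived L) = 1%N -> (\dim {:L} <= \dim (jac_space L) + 3)%N.
Proof.
move=> D1.
have [x [y xy]] : exists x y : L, lie x y != 0.
  by apply: derived_neq0; rewrite -dimv_eq0 D1.
have := dim_perp x y; rewrite D1 => /(_ isT).
have : (\dim (perp x y) <= (\dim (jac_space L)).+1)%N.
  apply: leq_trans (dim_wedgeL (perp x y) xy) _; rewrite ltnS; apply: dimvS.
  apply/subvP => _ /memv_imgP[t tp ->].
  by rewrite wedgeLE -jac_perp // mem_jac.
lia.
Qed.

(** Induction on m = dim [L, L]: modulo a central line of [L, L] both n and m drop
    by 1, and dim J drops by at least m - 1, by [dim_jac_quotient] applied to
    T = [L, L]. *)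
Theorem dim_jac_lower (L : finLieAlgType K) : nilpotent_lie L -> derived L != 0%VS ->
  (\dim {:L} + 'C(\dim (derived L), 2) <= \dim (derived L) + \dim (jac_space L) + 2)%N.
Proof.
move=> + D0; have [m dm] : exists m, \dim (derived L) = m.+1.
  by exists (\dim (derived L)).-1; rewrite prednK // lt0n dimv_eq0.
elim: m L D0 dm => [|m IH] L D0 dm nL.
  by rewrite dm bin_small // addn0; have := dim_jac_derived1 dm; lia.
have [z [z0 zD zc]] := nilpotent_center nL D0.
have [Q [q [qM qS qK]]] := central_quotient_exists zc.
have dQ := dim_quotient z0 qS qK.
have dD := dim_derived_quotient z0 qM qS qK zD.
have := dim_jac_quotient z0 qM qS qK (fun t => central_wedge_derived zc).
have := IH Q _ _ (nilpotent_quotient qM qS nL).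
have -> : \dim (derived Q) = m.+1 by lia.
rewrite -dimv_eq0 => /(_ _ erefl); rewrite (_ : \dim _ != 0)%N; last by lia.
move=> /(_ isT); rewrite dQ dm ['C(m.+2, 2)]binS bin1; lia.
Qed.

End LowerBound.

(** * One-dimensional derived algebra *)

Lemma dim_add2 (K : fieldType) (V : vectType K) (U C : {vspace V}) (x y : V) :
  x \in U -> y \in U -> (C <= U)%VS ->
  (forall u, u \in U -> exists a b, u - a *: x - b *: y \in C) ->
  (forall a b, a *: x + b *: y \in C -> a = 0 /\ b = 0) ->
  \dim U = (\dim C + 2)%N.
Proof.
move=> xU yU CU dec ind.
have fxy : free [:: x; y].
  rewrite free_cons seq1_free span_seq1; apply/andP; split.
    apply/negP => /vlineP[k e].
    have [] := ind 1 (- k); last by move/eqP; rewrite oner_eq0.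
    by rewrite scale1r scaleNr e subrr mem0v.
  apply/eqP => y0; have [] := ind 0 1; first by rewrite scale0r scale1r add0r y0 mem0v.
  by move=> _ /eqP; rewrite oner_eq0.
have cap0 : (<<[:: x; y]>> :&: C = 0)%VS.
  apply/eqP; rewrite -subv0; apply/subvP => v; rewrite memv_cap span_cons span_seq1.
  move=> /andP[/memv_addP[_ /vlineP[a ->]] [_ /vlineP[b ->] ->] /ind[-> ->]].
  by rewrite !scale0r addr0 mem0v.
have <- : (<<[:: x; y]>> + C)%VS = U.
  apply/eqP; rewrite eqEsubv subv_add CU andbT; apply/andP; split.
    by apply/span_subvP => v; rewrite !inE => /orP[] /eqP ->.
  apply/subvP => u /dec[a [b h]].
  have -> : u = (a *: x + b *: y) + (u - a *: x - b *: y) by exact: sub2K.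
  apply: memv_add => //.
  by rewrite memvD // memvZ // memv_span // !inE eqxx ?orbT.
by rewrite dimv_disjoint_sum // addnC; congr (_ + _)%N; exact: (eqP fxy).
Qed.

Section DerivedLine.
Context (K : fieldType) (L : finLieAlgType K).
Implicit Types x y z w : L.

Lemma derived_line w : \dim (derived L) = 1%N -> w \in derived L -> w != 0 ->
  derived L = <[w]>%VS.
Proof.
move=> D1 wD w0; apply/esym/eqP; rewrite eqEdim -memvE wD D1 dim_vline w0 //.
Qed.

Lemma derived_line_central w : nilpotent_lie L -> \dim (derived L) = 1%N ->
  w \in derived L -> central w.
Proof.
move=> nL D1 wD; have D0 : derived L != 0%VS by rewrite -dimv_eq0 D1.
have [z [z0 zD zc]] := nilpotent_center nL D0.
move: wD; rewrite (derived_line D1 zD z0) => /vlineP[k ->] t.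
by rewrite lieZl zc scaler0.
Qed.

Lemma hyperbolic_split x y t : \dim (derived L) = 1%N -> lie x y != 0 ->
  exists a b, t - a *: x - b *: y \in perp x y.
Proof.
move=> D1 xy0; have DE := derived_line D1 (mem_derived x y) xy0.
have := mem_derived x t; have := mem_derived y t.
rewrite DE => /vlineP[a ya] /vlineP[b xb]; exists (- a), b.
apply/perpP; rewrite scaleNr opprK !lieDr !lieNr !lieZr !liexx xb ya.
by rewrite !scaler0 addr0 subrr subr0 [lie y x]lieC scalerN subrr.
Qed.

Lemma hyperbolic_indep x y a b : lie x y != 0 -> a *: x + b *: y \in perp x y ->
  a = 0 /\ b = 0.
Proof.
move=> xy0 /perpP[]; rewrite !lieDr !lieZr !liexx !scaler0 add0r addr0 => /eqP.
rewrite scaler_eq0 (negPf xy0) orbF => /eqP -> /eqP.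
by rewrite lieC scalerN oppr_eq0 scaler_eq0 (negPf xy0) orbF => /eqP ->.
Qed.

(** With w = [x, y], J contains w ^ t for t in the orthogonal of either plane.
    The two orthogonals together span L, because each plane lies in the
    orthogonal of the other. *)
Lemma dim_jac_two_planes x y a b : \dim (derived L) = 1%N ->
  lie x y != 0 -> a \in perp x y -> b \in perp x y -> lie a b != 0 ->
  (\dim {:L} <= (\dim (jac_space L)).+1)%N.
Proof.
move=> D1 xy0 /perpP[xa ya] /perpP[xb yb] ab0.
pose T : {vspace L} := (wedgeL (lie x y) @^-1: jac_space L)%VS.
have TE t : (t \in T) = (wedge (lie x y) t \in jac_space L).
  by rewrite -memv_preim wedgeLE.
have xyT t : t \in perp x y -> t \in T by move=> h; rewrite TE -jac_perp // mem_jac.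
have abT t : t \in perp a b -> t \in T.
  move=> h; rewrite TE; have := mem_derived x y.
  rewrite (derived_line D1 (mem_derived a b) ab0) => /vlineP[k ->].
  by rewrite wedgeZl memvZ // -jac_perp // mem_jac.
have Tf : T = fullv.
  apply/vspaceP => t; rewrite memvf.
  have [c [d h]] := hyperbolic_split t D1 xy0.
  have -> : t = (c *: x + d *: y) + (t - c *: x - d *: y) by exact: sub2K.
  apply: memvD; last exact: xyT.
  by apply: memvD; apply: memvZ; apply: abT; apply/perpP;
    rewrite lieC [lie b _]lieC ?xa ?xb ?ya ?yb oppr0.
rewrite -[X in (X <= _)%N]/(\dim {:L}) -Tf.
apply: leq_trans (dim_wedgeL T xy0) _; rewrite ltnS; apply: dimvS.
by apply/subvP => _ /memv_imgP[t tT ->]; rewrite wedgeLE -TE.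
Qed.
End DerivedLine.

Lemma lie_isomorphic_of_surjection (K : fieldType) (L M : finLieAlgType K)
    (g : {linear M -> L}) :
  {morph g : x y / lie x y} -> (forall u, exists x, g x = u) ->
  \dim {:M} = \dim {:L} -> lie_isomorphic L M.
Proof.
move=> gM gS dML; pose gl : 'Hom(M, L) := linfun g.
have glE x : gl x = g x by rewrite lfunE.
have gf : limg gl = fullv.
  by apply/vspaceP => u; rewrite memvf; have [x <-] := gS u; rewrite -glE memv_img ?memvf.
have k0 : lker gl == 0%VS.
  rewrite -dimv_eq0; have := limg_ker_dim gl {:M}; rewrite capfv gf; lia.
have gK : cancel gl gl^-1%VF by exact: lker0_lfunK.
have Kg : cancel gl^-1%VF gl by move=> u; rewrite limg_lfunVK // gf memvf.
exists gl^-1%VF; split; last by exists gl.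
split=> [a u v|u v]; first by rewrite linearP.
by apply: (can_inj gK); rewrite Kg glE gM -!glE !Kg.
Qed.

Section Heisenberg.
Context (K : fieldType) (L : finLieAlgType K) (z : L).

(** Symplectic pairs and a radical, for the form defined by
    [lie x y = form x y *: z]. *)
Record symplectic_family (p k : nat) (X Y : 'I_p -> L) (A : 'I_k -> L) : Prop :=
  SymplecticFamily {
    symp_XY : forall i j, lie (X i) (Y j) = (i == j)%:R *: z;
    symp_XX : forall i j, lie (X i) (X j) = 0;
    symp_YY : forall i j, lie (Y i) (Y j) = 0;
    symp_AX : forall i j, lie (A i) (X j) = 0;
    symp_AY : forall i j, lie (A i) (Y j) = 0;
    symp_AA : forall i j, lie (A i) (A j) = 0
  }.

Definition comb3 (p k : nat) (X Y : 'I_p -> L) (A : 'I_k -> L) a b c : L :=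
  \sum_i a i *: X i + \sum_i b i *: Y i + \sum_i c i *: A i.

(** Splitting off one hyperbolic plane at a time.  Only the identity [x, x] = 0
    is involved, so the characteristic is arbitrary. *)
Lemma symplectic_family_exists (U : {vspace L}) :
  (forall x y, x \in U -> y \in U -> lie x y \in <[z]>%VS) -> z != 0 ->
  exists p k (X Y : 'I_p -> L) (A : 'I_k -> L),
    [/\ symplectic_family X Y A, \dim U = (2 * p + k)%N,
        [/\ forall i, X i \in U, forall i, Y i \in U & forall i, A i \in U]
      & forall u, u \in U -> exists a b c, u = comb3 X Y A a b c].
Proof.
move: {2}(\dim U).+1 (ltnSn (\dim U)) => d; elim: d U => // d IH U dU brU z0.
have [ab|/existsNP[x /existsNP[y' /not_implyP[xU /not_implyP[y'U /eqP xy0]]]]] :=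
    pselect (forall x y, x \in U -> y \in U -> lie x y = 0).
  pose A (i : 'I_(\dim U)) := (vbasis U)`_i.
  have AU i : A i \in U by apply: vbasis_mem; rewrite mem_nth ?size_tuple.
  exists 0%N, (\dim U), (fun=> 0), (fun=> 0), A; split=> //.
  - by split=> [[]|[]|[]|i []|i []|i j] //; apply: ab.
  - by split=> [[]|[]|].
  - move=> u uU; exists (fun=> 0), (fun=> 0), (fun i => coord (vbasis U) i u).
    by rewrite /comb3 !big_ord0 !add0r; exact: coord_vbasis.
have /vlineP[s es] := brU _ _ xU y'U.
have s0 : s != 0 by apply: contraNneq xy0 => s0; rewrite es s0 scale0r.
have [y yU xy] : exists2 y, y \in U & lie x y = z.
  by exists (s^-1 *: y'); rewrite ?memvZ // lieZr es scalerA mulVf // scale1r.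
pose U' := (U :&: perp x y)%VS.
have inU' t : t \in U' -> [/\ t \in U, lie x t = 0 & lie y t = 0].
  by rewrite memv_cap => /andP[-> /perpP[]].
have xyz0 : lie x y != 0 by rewrite xy.
have dec u : u \in U -> exists a b, u - a *: x - b *: y \in U'.
  move=> uU; have /vlineP[a ea] := brU _ _ yU uU; have /vlineP[b eb] := brU _ _ xU uU.
  exists (- a), b; apply/memv_capP; split; first by rewrite !memvB ?memvZ.
  apply/perpP.
  rewrite scaleNr opprK !lieDr !lieNr !lieZr !liexx [lie y x]lieC xy ea eb.
  by rewrite !scaler0 addr0 subrr subr0 scalerN subrr.
have dUU' : \dim U = (\dim U' + 2)%N.
  apply: dim_add2 xU yU (capvSl _ _) dec _ => a b; rewrite memv_cap => /andP[_].
  exact: hyperbolic_indep.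
have [|u v /inU'[uU _ _] /inU'[vU _ _]|//|p [k [X [Y [A [[XY XX YY AX AY AA] dU' [XU YU AU] sp]]]]]] := IH U'.
- by lia.
- exact: brU.
pose X' (i : 'I_p.+1) := oapp X x (unlift ord0 i).
pose Y' (i : 'I_p.+1) := oapp Y y (unlift ord0 i).
have X0 : X' ord0 = x by rewrite /X' unlift_none.
have Y0 : Y' ord0 = y by rewrite /Y' unlift_none.
have XS i : X' (lift ord0 i) = X i by rewrite /X' liftK.
have YS i : Y' (lift ord0 i) = Y i by rewrite /Y' liftK.
have cx t : t \in U' -> lie t x = 0 by move=> /inU'[_ h _]; rewrite lieC h oppr0.
have cy t : t \in U' -> lie t y = 0 by move=> /inU'[_ _ h]; rewrite lieC h oppr0.
have xc t : t \in U' -> lie x t = 0 by case/inU'.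
have yc t : t \in U' -> lie y t = 0 by case/inU'.
exists p.+1, k, X', Y', A; split.
- split=> i j.
  + case: (unliftP ord0 i) => [i' ->|->]; case: (unliftP ord0 j) => [j' ->|->].
    * by rewrite XS YS XY (inj_eq (@lift_inj _ ord0)).
    * by rewrite XS Y0 cy // eq_sym (negPf (neq_lift _ _)) scale0r.
    * by rewrite X0 YS xc // (negPf (neq_lift _ _)) scale0r.
    * by rewrite X0 Y0 eqxx scale1r.
  + by case: (unliftP ord0 i) => [i' ->|->]; case: (unliftP ord0 j) => [j' ->|->];
      rewrite ?XS ?X0 ?liexx ?cx ?xc.
  + by case: (unliftP ord0 i) => [i' ->|->]; case: (unliftP ord0 j) => [j' ->|->];
      rewrite ?YS ?Y0 ?liexx ?cy ?yc.
  + by case: (unliftP ord0 j) => [j' ->|->]; rewrite ?XS ?X0 ?cx.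
  + by case: (unliftP ord0 j) => [j' ->|->]; rewrite ?YS ?Y0 ?cy.
  + exact: AA.
- by rewrite dUU' dU'; lia.
- split=> i; try (case: (unliftP ord0 i) => [i' ->|->]);
    rewrite ?XS ?YS ?X0 ?Y0 ?xU ?yU //.
  + by case: (inU' _ (XU i')).
  + by case: (inU' _ (YU i')).
  + by case: (inU' _ (AU i)).
- move=> u uU; have [a0 [b0 /sp[a [b [c uE]]]]] := dec u uU.
  exists (fun i => oapp a a0 (unlift ord0 i)), (fun i => oapp b b0 (unlift ord0 i)), c.
  rewrite /comb3 !big_ord_recl /= !unlift_none X0 Y0 /=.
  under eq_bigr do rewrite liftK XS.
  under [X in _ + (_ + X)]eq_bigr do rewrite liftK YS.
  have -> : u = (a0 *: x + b0 *: y) + (u - a0 *: x - b0 *: y) by exact: sub2K.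
  by rewrite uE /comb3 [in RHS](addrACA (a0 *: x)) -!addrA.
Qed.

Lemma comb3_linear p k (X Y : 'I_p -> L) (A : 'I_k -> L) s a b c a' b' c' :
  comb3 X Y A (fun i => s * a i + a' i) (fun i => s * b i + b' i) (fun i => s * c i + c' i)
  = s *: comb3 X Y A a b c + comb3 X Y A a' b' c'.
Proof.
have E (I : finType) (u v : I -> K) (S : I -> L) :
    \sum_i (s * u i + v i) *: S i = s *: (\sum_i u i *: S i) + \sum_i v i *: S i.
  rewrite scaler_sumr -big_split; apply: eq_bigr => i _.
  by rewrite scalerDl scalerA.
by rewrite /comb3 !E !scalerDr [X in X + _]addrACA [LHS]addrACA.
Qed.

Lemma lie_comb3 p k (X Y : 'I_p -> L) (A : 'I_k -> L) a b c a' b' c' :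
  symplectic_family X Y A ->
  lie (comb3 X Y A a b c) (comb3 X Y A a' b' c') = (\sum_i (a i * b' i - a' i * b i)) *: z.
Proof.
case=> XY XX YY AX AY AA.
have Z (I J : finType) (S : I -> L) (T : J -> L) u v :
    (forall i j, lie (S i) (T j) = 0) ->
    lie (\sum_i u i *: S i) (\sum_j v j *: T j) = 0.
  move=> h; rewrite (alt_suml (alt_lie L)) big1 // => i _.
  by rewrite (alt_sumr (alt_lie L)) big1 // => j _; rewrite lieZl lieZr h !scaler0.
have XYs u v : lie (\sum_i u i *: X i) (\sum_i v i *: Y i) = (\sum_i u i * v i) *: z.
  rewrite (alt_suml (alt_lie L)) scaler_suml; apply: eq_bigr => i _.
  rewrite (alt_sumr (alt_lie L)) (bigD1 i) //= big1 ?addr0.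
    by rewrite lieZl lieZr XY eqxx scale1r scalerA.
  move=> j ij; rewrite lieZl lieZr XY eq_sym (negPf ij) scale0r !scaler0 //.
rewrite /comb3 !lieDl !lieDr XYs (lieC (\sum_i b i *: Y i)) XYs.
have XA i j : lie (X i) (A j) = 0 by rewrite lieC AX oppr0.
have YA i j : lie (Y i) (A j) = 0 by rewrite lieC AY oppr0.
rewrite !Z // !add0r !addr0 -scaleNr -scalerDl; congr (_ *: z).
by rewrite -sumrB; apply: eq_bigr => i _.
Qed.

(** A symplectic family in a complement of <z>, completed by z itself, is a basis
    with the bracket table of the Heisenberg algebra plus an abelian one. *)
Lemma heisenberg_iso :
  \dim (derived L) = 1%N -> derived L = <[z]>%VS -> central z ->
  exists p k, [/\ \dim {:L} = (2 * p + 1 + k)%N &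
    lie_isomorphic L (heisenberg K p * abelian_lie K k)%type].
Proof.
move=> D1 DE zc.
have z0 : z != 0 by apply: contra_eqN D1 => /eqP z0; rewrite DE dim_vline z0 eqxx.
pose U : {vspace L} := (<[z]>^C)%VS.
have dU : \dim {:L} = (\dim U).+1.
  rewrite -[LHS]/(\dim {:L}) -(addv_complf <[z]>%VS) dimv_disjoint_sum ?capv_compl //.
  by rewrite dim_vline z0.
have [p [k [X [Y [A [[XY XX YY AX AY AA] dU' [XU YU AU] sp]]]]]] :
    exists p k (X Y : 'I_p -> L) (A : 'I_k -> L),
    [/\ symplectic_family X Y A, \dim U = (2 * p + k)%N,
        [/\ forall i, X i \in U, forall i, Y i \in U & forall i, A i \in U]
      & forall u, u \in U -> exists a b c, u = comb3 X Y A a b c].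
  by apply: symplectic_family_exists => // x y _ _; rewrite -DE mem_derived.
exists p, k; split=> //; first by rewrite dU dU'; lia.
pose M := (heisenberg K p * abelian_lie K k)%type.
pose g (v : M) : L :=
  comb3 X Y A (v.1.1.1 0) (v.1.1.2 0) (v.2 0) + (v.1.2 : K) *: z.
have gl : linear g.
  move=> s u v; rewrite /g scalerDr addrACA -comb3_linear; congr (_ + _).
    by rewrite /comb3 /=; congr (_ + _ + _); apply: eq_bigr => i _; rewrite !mxE.
  by rewrite scalerA -scalerDl.
pose g' : {linear M -> L} := HB.pack g (GRing.isLinear.Build K M L *:%R g gl).
apply: (@lie_isomorphic_of_surjection K L M g').
- have lie_modz s t a b : lie (s + a *: z) (t + b *: z) = lie s t.
    by rewrite lieDl !lieDr !lieZl !lieZr !(centralr _ zc) zc !scaler0 !addr0.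
  move=> u v; rewrite /= /g lie_modz (lie_comb3 _ _ _ _ _ _ (SymplecticFamily XY XX YY AX AY AA)).
  rewrite [X in X + _ = _](_ : _ = 0) ?add0r //.
  by rewrite /comb3 !big1 ?addr0 //= => i _; rewrite mxE scale0r.
- move=> t; have [a [b [c tE]]] := sp _ (memv_projC <[z]>%VS t).
  have /vlineP[d zE] := memv_proj <[z]>%VS t.
  exists ((\row_i a i, \row_i b i, d), \row_i c i) => /=; rewrite /g /=.
  rewrite -[RHS](subrK (projv <[z]>%VS t)) tE zE; congr (_ + _).
  by rewrite /comb3; congr (_ + _ + _); apply: eq_bigr => i _; rewrite mxE.
- rewrite dU dU' dimvf -[LHS]/(1 * p + 1 * p + 1 + 1 * k)%N; lia.
Qed.
End Heisenberg.

Section Invariance.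
Context (K : fieldType).

(** A surjective morphism maps both [L, L] and J onto their counterparts. *)
Lemma surjection_dims (L M : finLieAlgType K) (f : {linear L -> M}) :
  {morph f : x y / lie x y} -> (forall u, exists x, f x = u) ->
  [/\ (\dim {:M} <= \dim {:L})%N, (\dim (derived M) <= \dim (derived L))%N
    & (\dim (jac_space M) <= \dim (jac_space L))%N].
Proof.
move=> fM fS; split.
- rewrite -(limg_ker_dim (linfun f : 'Hom(L, M)) {:L}) (_ : limg _ = fullv) ?leq_addl //.
  apply/vspaceP => u; rewrite memvf; have [x <-] := fS u.
  by rewrite -(lfunE f) memv_img ?memvf.
- by rewrite -(derived_quotient fM fS) -[X in (_ <= X)%N](limg_ker_dim (linfun f)) leq_addl.
- by rewrite -(jac_quotient fM fS) -[X in (_ <= X)%N](limg_ker_dim (ext2_map f)) leq_addl.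
Qed.

Lemma isomorphic_dims (L M : finLieAlgType K) : lie_isomorphic L M ->
  [/\ \dim {:L} = \dim {:M}, \dim (derived L) = \dim (derived M)
    & \dim (jac_space L) = \dim (jac_space M)].
Proof.
move=> [f [[fl fM] [g fK gK]]].
have gl : linear g by move=> a u v; apply: (can_inj fK); rewrite gK fl !gK.
pose f' : {linear L -> M} := HB.pack f (GRing.isLinear.Build K L M *:%R f fl).
pose g' : {linear M -> L} := HB.pack g (GRing.isLinear.Build K M L *:%R g gl).
have [|u|h1 h2 h3] := @surjection_dims L M f'.
- exact: fM.
- by exists (g u); exact: gK.
have [u v|u|h4 h5 h6] := @surjection_dims M L g'.
- by apply: (can_inj fK); rewrite fM !gK.
- by exists (f u); exact: fK.
by split; apply/eqP; rewrite eqn_leq ?h1 ?h2 ?h3 ?h4 ?h5 ?h6.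
Qed.

Lemma abelian_dims (L : finLieAlgType K) : (forall u v : L, lie u v = 0) ->
  (\dim (derived L) + \dim (jac_space L) = 0)%N.
Proof.
move=> br; apply/eqP; rewrite addn_eq0 !dimv_eq0 -!subv0; apply/andP; split.
  by apply: derived_sub => u v; rewrite br mem0v.
by apply: jac_space_sub => u v t; rewrite /jac !br !wedge0l !addr0 mem0v.
Qed.

(** All generators of J lie in w ^ L, where w spans [L, L]. *)
Lemma dim_jac_derived_line (L : finLieAlgType K) :
  \dim (derived L) = 1%N -> (\dim (jac_space L) < \dim {:L})%N.
Proof.
move=> D1; have D0 : derived L != 0%VS by rewrite -dimv_eq0 D1.
have [x [y xy0]] := derived_neq0 D0.
have DE := derived_line D1 (mem_derived x y) xy0.
have Df := dim_wedgeL_eq xy0 (memvf (lie x y)).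
rewrite -[X in (_ < X)%N]/(\dim {:L}) Df ltnS; apply: dimvS.
apply: jac_space_sub => a b c; rewrite /jac.
have W u v t : wedge (lie u v) t \in (wedgeL (lie x y) @: fullv)%VS.
  have := mem_derived u v; rewrite DE => /vlineP[k ->].
  by rewrite wedgeZl memvZ // -wedgeLE memv_img ?memvf.
by rewrite !memvD.
Qed.

(** In [jac a b c] the components of a, b, c along the plane contribute the
    expansion of a 3 x 3 determinant with two equal rows, hence cancel. *)
Lemma dim_jac_one_plane (L : finLieAlgType K) (x y : L) :
  \dim (derived L) = 1%N -> lie x y != 0 -> central (lie x y) ->
  (forall a b, a \in perp x y -> b \in perp x y -> lie a b = 0) ->
  (\dim (jac_space L) + 3 <= \dim {:L})%N.
Proof.
move=> D1 xy0 wc ab.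
have dL : \dim {:L} = (\dim (perp x y) + 2)%N.
  apply: (@dim_add2 _ _ _ _ x y); rewrite ?memvf ?subvf //.
    by move=> u _; exact: hyperbolic_split.
  by move=> a b; exact: hyperbolic_indep.
have wp : lie x y \in perp x y by apply/perpP; rewrite !(centralr _ wc).
rewrite dL (dim_wedgeL_eq xy0 wp) addSn addn2 addn3 !ltnS; apply: dimvS.
apply: jac_space_sub => a b c.
have dec (t : L) : exists p q s, s \in perp x y /\ t = p *: x + q *: y + s.
  have [p [q h]] := hyperbolic_split t D1 xy0.
  exists p, q, (t - p *: x - q *: y); split=> //.
  exact: sub2K.
have [pa [qa [sa [sap ->]]]] := dec a; have [pb [qb [sb [sbp ->]]]] := dec b.
have [pc [qc [sc [scp ->]]]] := dec c.
have br p q s p' q' s' : s \in perp x y -> s' \in perp x y ->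
    lie (p *: x + q *: y + s) (p' *: x + q' *: y + s') = (p * q' - p' * q) *: lie x y.
  move=> sp sp'; have [xs ys] := perpP _ _ _ sp; have [xs' ys'] := perpP _ _ _ sp'.
  rewrite !lieDl !lieDr !lieZl !lieZr !liexx xs' ys' (lieC s x) (lieC s y) xs ys (ab s s') //.
  rewrite !oppr0 !scaler0 !addr0 !add0r (lieC y x) !scalerN !scalerA -scaleNr -scalerDl.
  by congr (_ *: _); ring.
rewrite /jac !br // (_ : _ + _ = wedge (lie x y) ((pa * qb - pb * qa) *: sc
   + (pb * qc - pc * qb) *: sa + (pc * qa - pa * qc) *: sb)).
  by rewrite -wedgeLE memv_img // !memvD // memvZ.
apply/ffunP => i; rewrite !ffunE !vcoordE; ring.
Qed.

Section HeisenbergModel.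
Context (p k : nat).
Let M : finLieAlgType K := (heisenberg K p * abelian_lie K k)%type.

Definition heis_x (i : 'I_p) : M := ((delta_mx 0 i, 0, 0), 0).
Definition heis_y (i : 'I_p) : M := ((0, delta_mx 0 i, 0), 0).
Definition heis_z : M := ((0, 0, 1), 0).

Lemma heis_lieE (u v : M) :
  lie u v = (\sum_(i < p) (u.1.1.1 0 i * v.1.1.2 0 i - v.1.1.1 0 i * u.1.1.2 0 i)) *: heis_z.
Proof.
rewrite -[LHS]/((0, 0, _), 0) /heis_z.
congr (_, _); last by rewrite /= scaler0.
by congr (_, _, _); rewrite /= ?scaler0 // /GRing.scale /= mulr1.
Qed.

Lemma heis_lie_xl i (v : M) : lie (heis_x i) v = v.1.1.2 0 i *: heis_z.
Proof.
rewrite heis_lieE; congr (_ *: _); rewrite (bigD1 i) //= big1 => [|j ji].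
  by rewrite !mxE !eqxx mul1r mulr0 subr0 addr0.
by rewrite !mxE (negPf ji) andbF mul0r mulr0 subr0.
Qed.

Lemma heis_lie_yl i (v : M) : lie (heis_y i) v = - v.1.1.1 0 i *: heis_z.
Proof.
rewrite heis_lieE; congr (_ *: _); rewrite (bigD1 i) //= big1 => [|j ji].
  by rewrite !mxE !eqxx mulr1 mul0r sub0r addr0.
by rewrite !mxE (negPf ji) andbF mul0r mulr0 subr0.
Qed.

Lemma heis_z_neq0 : heis_z != 0.
Proof.
by apply/eqP => /(congr1 (fun v : M => v.1.2)) /eqP; rewrite oner_eq0.
Qed.

Lemma heis_z_central : central heis_z.
Proof.
by move=> v; rewrite heis_lieE big1 ?scale0r // => i _; rewrite !mxE mul0r mulr0 subr0.
Qed.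

Lemma heis_derived : (0 < p)%N -> derived M = <[heis_z]>%VS.
Proof.
move=> p0; apply/eqP; rewrite eqEsubv; apply/andP; split.
  by apply: derived_sub => u v; rewrite heis_lieE memvZ // memv_line.
have -> : heis_z = lie (heis_x (Ordinal p0)) (heis_y (Ordinal p0)).
  by rewrite heis_lie_xl /= mxE !eqxx scale1r.
by rewrite -memvE mem_derived.
Qed.

Lemma heis_dim_derived : (0 < p)%N -> \dim (derived M) = 1%N.
Proof. by move=> p0; rewrite heis_derived // dim_vline heis_z_neq0. Qed.

Lemma heis_dim : \dim {:M} = (2 * p + 1 + k)%N.
Proof. rewrite dimvf -[LHS]/(1 * p + 1 * p + 1 + 1 * k)%N; lia. Qed.

Lemma heis_xy i : lie (heis_x i) (heis_y i) = heis_z.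
Proof. by rewrite heis_lie_xl /= mxE !eqxx scale1r. Qed.

Lemma heisenberg_dims : (2 <= p)%N -> (\dim (derived M) + \dim (jac_space M) = \dim {:M})%N.
Proof.
move=> p2; have p0 : (0 < p)%N by exact: ltnW.
pose i0 : 'I_p := Ordinal p0; pose i1 : 'I_p := Ordinal p2.
have D1 := heis_dim_derived p0.
have : (\dim {:M} <= (\dim (jac_space M)).+1)%N.
  apply: (@dim_jac_two_planes _ _ (heis_x i0) (heis_y i0) (heis_x i1) (heis_y i1)) => //.
  - by rewrite heis_xy heis_z_neq0.
  - by apply/perpP; rewrite heis_lie_xl heis_lie_yl /= !mxE oppr0 scale0r.
  - by apply/perpP; rewrite heis_lie_xl heis_lie_yl /= !mxE oppr0 scale0r.
  - by rewrite heis_xy heis_z_neq0.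
have := dim_jac_derived_line D1; rewrite D1; lia.
Qed.

End HeisenbergModel.

Lemma heisenberg_dims_small p k : (p <= 1)%N ->
  (\dim (derived (heisenberg K p * abelian_lie K k)%type)
   + \dim (jac_space (heisenberg K p * abelian_lie K k)%type)
   < \dim {:(heisenberg K p * abelian_lie K k)%type})%N.
Proof.
case: p => [|[|p]] // _.
- rewrite abelian_dims ?heis_dim // => u v.
  by rewrite heis_lieE big_ord0 scale0r.
- rewrite heis_dim_derived // add1n.
  have z0 := @heis_z_neq0 1 k.
  apply: leq_trans (@dim_jac_one_plane _ (heis_x k ord0) (heis_y k ord0) _ _ _ _).
  + by rewrite addn3.
  + exact: heis_dim_derived.
  + by rewrite heis_xy.
  + by rewrite heis_xy; exact: heis_z_central.
  + move=> a b /perpP[+ +] /perpP[+ +].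
    rewrite !heis_lie_xl !heis_lie_yl heis_lieE big_ord1.
    move=> /eqP; rewrite scaler_eq0 (negPf z0) orbF => /eqP ->.
    move=> _ /eqP; rewrite scaler_eq0 (negPf z0) orbF => /eqP ->.
    by rewrite !mulr0 subr0 scale0r.
Qed.

Theorem derived_line_classification (L : finLieAlgType K) :
  nilpotent_lie L -> \dim (derived L) = 1%N ->
  (\dim (derived L) + \dim (jac_space L) = \dim {:L})%N ->
  exists p k, [/\ (2 <= p)%N, \dim {:L} = (2 * p + 1 + k)%N &
    lie_isomorphic L (heisenberg K p * abelian_lie K k)%type].
Proof.
move=> nL D1 e.
have [z [z0 zD zc]] : exists z, [/\ z != 0, z \in derived L & central z].
  by apply: nilpotent_center => //; rewrite -dimv_eq0 D1.
have [p [k [dL iso]]] := heisenberg_iso D1 (derived_line D1 zD z0) zc.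
exists p, k; split=> //; rewrite ltnNge; apply/negP => /(heisenberg_dims_small k) /=.
by have [<- <- <-] := isomorphic_dims iso; rewrite e ltnn.
Qed.

End Invariance.

(** * Bracket tables of the two exceptional algebras *)

Section FiliformTable.
Context (K : fieldType) (L : finLieAlgType K) (x y w z : L).

Record filiform_table : Prop := FiliformTable {
  fil_xy : lie x y = w; fil_xw : lie x w = z; fil_xz : lie x z = 0;
  fil_yw : lie y w = 0; fil_yz : lie y z = 0; fil_wz : lie w z = 0;
  fil_span : forall t : L, exists a b c d, t = a *: x + b *: y + c *: w + d *: z
}.

Context (tab : filiform_table).

Lemma filiform_lie a b c d a' b' c' d' :
  lie (a *: x + b *: y + c *: w + d *: z) (a' *: x + b' *: y + c' *: w + d' *: z)
  = (a * b' - a' * b) *: w + (a * c' - a' * c) *: z.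
Proof.
case: tab => xy xw xz yw yz wz _.
have yx : lie y x = - w by rewrite lieC xy.
have wx : lie w x = - z by rewrite lieC xw.
have zx : lie z x = 0 by rewrite lieC xz oppr0.
have wy : lie w y = 0 by rewrite lieC yw oppr0.
have zy : lie z y = 0 by rewrite lieC yz oppr0.
have zw : lie z w = 0 by rewrite lieC wz oppr0.
rewrite !lieDl !lieDr !lieZl !lieZr !liexx xy xw xz yw yz wz yx wx zx wy zy zw.
by apply: vcoord_inj => i; rewrite !vcoordE; ring.
Qed.

Lemma filiform_iso : \dim {:L} = 4%N -> lie_isomorphic L (L3414 K).
Proof.
move=> dL.
pose g (v : L3414 K) : L := v 0 0 *: x + v 0 1 *: y + v 0 2 *: w + v 0 3 *: z.
have gl : linear g.
  by move=> s u v; apply: vcoord_inj => i; rewrite /g !vcoordE !mxE; ring.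
pose g' : {linear L3414 K -> L} := HB.pack g (GRing.isLinear.Build K (L3414 K) L *:%R g gl).
apply: (@lie_isomorphic_of_surjection _ L (L3414 K) g').
- move=> u v /=; rewrite /g filiform_lie -[lie u v]/(L3414_br u v) /L3414_br !mxE /=.
  by apply: vcoord_inj => i; rewrite !vcoordE; ring.
- move=> t; have [a [b [c [d ->]]]] := fil_span tab t.
  exists (\row_i nth 0 [:: a; b; c; d] i); by rewrite /= /g !mxE.
- by rewrite dL dimvf.
Qed.

Lemma filiform_jac : (\dim (jac_space L) <= 2)%N.
Proof.
apply: leq_trans (dim_span [:: wedge z y; wedge w z]).
apply: dimvS; apply: jac_space_sub => u v t.
have [a [b [c [d ->]]]] := fil_span tab u.
have [a' [b' [c' [d' ->]]]] := fil_span tab v.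
have [a'' [b'' [c'' [d'' ->]]]] := fil_span tab t.
rewrite /jac !filiform_lie !span_cons span_nil addv0.
rewrite (_ : _ + _ =
  (- (a * (b' * c'' - b'' * c') - a' * (b * c'' - b'' * c) + a'' * (b * c' - b' * c)))
    *: wedge z y
  + ((a * b' - a' * b) * d'' + (a' * b'' - a'' * b') * d + (a'' * b - a * b'') * d')
    *: wedge w z); first by rewrite memv_add // memvZ // memv_line.
by apply/ffunP => i; rewrite !ffunE !vcoordE /GRing.scale /=; ring.
Qed.
End FiliformTable.

Section TwoStepTable.
Context (K : fieldType) (L : finLieAlgType K) (x y a w z b : L).

(** The vector [b] spans the abelian summand; it may be zero, in which case this
    is the table of L(4,5,2,4) itself. *)
Record two_step_table : Prop := TwoStepTable {
  two_xy : lie x y = w; two_xa : lie x a = z; two_xb : lie x b = 0;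
  two_ya : lie y a = 0; two_yb : lie y b = 0; two_ab : lie a b = 0;
  two_w : central w; two_z : central z;
  two_span : forall t : L, exists c0 c1 c2 c3 c4 c5,
    t = c0 *: x + c1 *: y + c2 *: a + c3 *: w + c4 *: z + c5 *: b
}.

Context (tab : two_step_table).

Lemma two_step_lie c0 c1 c2 c3 c4 c5 d0 d1 d2 d3 d4 d5 :
  lie (c0 *: x + c1 *: y + c2 *: a + c3 *: w + c4 *: z + c5 *: b)
      (d0 *: x + d1 *: y + d2 *: a + d3 *: w + d4 *: z + d5 *: b)
  = (c0 * d1 - d0 * c1) *: w + (c0 * d2 - d0 * c2) *: z.
Proof.
case: tab => xy xa xb ya yb ab wc zc _.
have yx : lie y x = - w by rewrite lieC xy.
have ax : lie a x = - z by rewrite lieC xa.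
have bx : lie b x = 0 by rewrite lieC xb oppr0.
have ay : lie a y = 0 by rewrite lieC ya oppr0.
have by_ : lie b y = 0 by rewrite lieC yb oppr0.
have ba : lie b a = 0 by rewrite lieC ab oppr0.
rewrite !lieDl !lieDr !lieZl !lieZr !liexx !wc !zc !(centralr _ wc) !(centralr _ zc).
rewrite xy xa xb ya yb ab yx ax bx ay by_ ba.
by apply: vcoord_inj => i; rewrite !vcoordE; ring.
Qed.

Lemma two_step_iso : \dim {:L} = 6%N ->
  lie_isomorphic L (L4524 K * abelian_lie K 1)%type.
Proof.
move=> dL; pose M := (L4524 K * abelian_lie K 1)%type.
pose g (v : M) : L := v.1 0 0 *: x + v.1 0 1 *: y + v.1 0 2 *: a + v.1 0 3 *: w
   + v.1 0 4 *: z + v.2 0 0 *: b.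
have gl : linear g.
  by move=> s u v; apply: vcoord_inj => i; rewrite /g !vcoordE !mxE; ring.
pose g' : {linear M -> L} := HB.pack g (GRing.isLinear.Build K M L *:%R g gl).
apply: (@lie_isomorphic_of_surjection _ L M g').
- move=> u v /=; rewrite /g two_step_lie.
  rewrite -[(lie u v).1]/(L4524_br u.1 v.1) -[(lie u v).2]/(0 : 'rV[K]_1).
  rewrite /L4524_br !mxE /=.
  by apply: vcoord_inj => i; rewrite !vcoordE; ring.
- move=> t; have [c0 [c1 [c2 [c3 [c4 [c5 ->]]]]]] := two_span tab t.
  exists (\row_i nth 0 [:: c0; c1; c2; c3; c4] i, \row_i c5); by rewrite /= /g /= !mxE.
- by rewrite dL dimvf.
Qed.

Definition two_step_jac_seq :=
  [:: wedge w a - wedge z y; wedge w z; wedge w b; wedge z b].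

Lemma two_step_jac : (jac_space L <= <<two_step_jac_seq>>)%VS.
Proof.
apply: jac_space_sub => u v t.
have [c0 [c1 [c2 [c3 [c4 [c5 ->]]]]]] := two_span tab u.
have [d0 [d1 [d2 [d3 [d4 [d5 ->]]]]]] := two_span tab v.
have [e0 [e1 [e2 [e3 [e4 [e5 ->]]]]]] := two_span tab t.
rewrite /jac !two_step_lie /two_step_jac_seq.
(* The 3 x 3 minors on the coordinates (0, 1, i), resp. (0, 2, i). *)
pose p k l m := (c0 * d1 - d0 * c1) * m + (d0 * e1 - e0 * d1) * k + (e0 * c1 - c0 * e1) * l.
pose q k l m := (c0 * d2 - d0 * c2) * m + (d0 * e2 - e0 * d2) * k + (e0 * c2 - c0 * e2) * l.
rewrite (_ : _ + _ = p c2 d2 e2 *: (wedge w a - wedge z y)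
  + (p c4 d4 e4 - q c3 d3 e3) *: wedge w z + p c5 d5 e5 *: wedge w b
  + q c5 d5 e5 *: wedge z b).
  by rewrite !memvD // memvZ // memv_span // !inE eqxx ?orbT.
by apply/ffunP => i; rewrite /p /q !ffunE !vcoordE /GRing.scale /=; ring.
Qed.

Lemma dim_two_step_jac : (\dim (jac_space L) <= 4)%N.
Proof. exact: leq_trans (dimvS two_step_jac) (dim_span _). Qed.

End TwoStepTable.

(** Without the abelian summand two of the four generators of J vanish. *)
Lemma dim_two_step_jac0 (K : fieldType) (L : finLieAlgType K) (x y a w z : L) :
  two_step_table x y a w z 0 -> (\dim (jac_space L) <= 2)%N.
Proof.
move=> tab; apply: leq_trans (dimvS (two_step_jac tab)) _.
rewrite /two_step_jac_seq !wedge0r.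
apply: leq_trans (dim_span [:: wedge w a - wedge z y; wedge w z]).
apply/dimvS/span_subvP => A; rewrite !inE => /or4P[]/eqP->.
- by rewrite memv_span // !inE eqxx.
- by rewrite memv_span // !inE eqxx orbT.
- exact: mem0v.
- exact: mem0v.
Qed.

(** * Two-dimensional derived algebra *)

Lemma dim_span2 (K : fieldType) (V : vectType K) (w z : V) :
  w \notin <[z]>%VS -> z != 0 -> \dim <<[:: w; z]>> = 2%N.
Proof.
move=> wz z0.
by apply/eqP; rewrite -[_ == _]/(free [:: w; z]) free_cons span_seq1 wz seq1_free z0.
Qed.

Lemma dimv_lt_mem (K : fieldType) (V : vectType K) (U W : {vspace V}) (v : V) :
  (U <= W)%VS -> v \in W -> v \notin U -> (\dim U < \dim W)%N.
Proof.
move=> UW vW vU; rewrite ltnNge; apply/negP => WU.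
by case/negP: vU; have /eqP -> : U == W by rewrite eqEdim UW.
Qed.

Section DerivedPlane.
Context (K : fieldType) (L : finLieAlgType K).
Implicit Types x y z w a b t : L.

(** Denoted by T in the comments. *)
Definition wedge_jac_space z : {vspace L} := (wedgeL z @^-1: jac_space L)%VS.

Lemma mem_wedge_jac z t : (t \in wedge_jac_space z) = (wedge z t \in jac_space L).
Proof. by rewrite -memv_preim wedgeLE. Qed.

(** The shape of L over a quotient L / <z> whose bracket is a form with a single
    hyperbolic plane: C is the preimage of the orthogonal of the plane <x, y>.  That
    C is abelian, and not only [C, C] <= <z>, depends on dim T <= 3, see
    [adapted_exists]. *)
Record adapted z x y (C : {vspace L}) : Prop := Adapted {
  ada_z0 : z != 0;
  ada_zc : central z;
  ada_zC : z \in C;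
  ada_wC : lie x y \in C;
  ada_wz : lie x y \notin <[z]>%VS;
  ada_xC : forall a, a \in C -> lie x a \in <[z]>%VS;
  ada_yC : forall a, a \in C -> lie y a \in <[z]>%VS;
  ada_CC : forall a b, a \in C -> b \in C -> lie a b = 0;
  ada_split : forall t, exists p q, t - p *: x - q *: y \in C;
  ada_indep : forall p q, p *: x + q *: y \in C -> p = 0 /\ q = 0
}.

Lemma adapted_shift z x y C k : adapted z x y C -> adapted z x (y - k *: x) C.
Proof.
case=> z0 zc zC wC wz xC yC CC sp ind.
have wE : lie x (y - k *: x) = lie x y by rewrite lieDr lieNr lieZr liexx scaler0 oppr0 addr0.
split; rewrite ?wE //.
- by move=> a aC; rewrite lieDl lieNl lieZl memvB ?memvZ ?xC ?yC.
- move=> t; have [p [q h]] := sp t; exists (p + q * k), q.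
  congr (_ \in C): h; apply: vcoord_inj => i; rewrite !vcoordE; ring.
- move=> p q h; have [] := ind (p - q * k) q.
    congr (_ \in C): h; apply: vcoord_inj => i; rewrite !vcoordE; ring.
  by move=> + q0; rewrite q0 mul0r subr0.
Qed.

Lemma adapted_swap z x y C : adapted z x y C -> adapted z y (- x) C.
Proof.
case=> z0 zc zC wC wz xC yC CC sp ind.
have wE : lie y (- x) = lie x y by rewrite lieNr [lie x y]lieC.
split; rewrite ?wE //.
- by move=> a aC; rewrite lieNl memvN xC.
- move=> t; have [p [q h]] := sp t; exists q, (- p).
  congr (_ \in C): h; apply: vcoord_inj => i; rewrite !vcoordE; ring.
- move=> p q h; have [] := ind (- q) p.
    congr (_ \in C): h; apply: vcoord_inj => i; rewrite !vcoordE; ring.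
  by move=> /eqP + p0; rewrite oppr_eq0 => /eqP.
Qed.

Lemma adapted_dim z x y C : adapted z x y C -> \dim {:L} = (\dim C + 2)%N.
Proof.
case=> _ _ _ _ _ _ _ _ sp ind.
by apply: (@dim_add2 _ _ _ _ x y); rewrite ?memvf ?subvf.
Qed.

Lemma adapted_dim_plane z x y C : adapted z x y C -> \dim <<[:: lie x y; z]>> = 2%N.
Proof.
by case=> z0 _ _ _ wz *; exact: dim_span2.
Qed.

Lemma bracket_wedge_jac z x y C : adapted z x y C -> lie x y \in wedge_jac_space z.
Proof.
by case=> _ zc *; rewrite mem_wedge_jac central_wedge_derived // mem_derived.
Qed.

Lemma self_wedge_jac z : z \in wedge_jac_space z.
Proof. by rewrite mem_wedge_jac wedgexx mem0v. Qed.

(** T contains C, by [jac x w a] for a in C, and y, by [jac x y w].  Hence C has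
    dimension 2. *)
Lemma adapted_filiform z x y C : adapted z x y C ->
  lie x (lie x y) != 0 -> lie y (lie x y) = 0 ->
  (\dim (wedge_jac_space z) <= 3)%N -> lie_isomorphic L (L3414 K).
Proof.
move=> hA; have [z0 zc zC wC wz xC yC CC sp ind] := hA => xw0 yw T3.
set w := lie x y in wC wz xw0 yw *.
have /vlineP[p xw] := xC _ wC.
have p0 : p != 0 by apply: contraNneq xw0 => p0; rewrite xw p0 scale0r.
have wT : w \in wedge_jac_space z by exact: bracket_wedge_jac hA.
have CT a : a \in C -> a \in wedge_jac_space z.
  move=> aC; have /vlineP[p' xa] := xC _ aC.
  have E : p *: wedge z a = jac x w a + p' *: wedge z w.
    by rewrite /jac xw (CC w a) // (lieC a) xa wedge0l addr0 wedgeNl !wedgeZl subrK.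
  have : p *: wedge z a \in jac_space L by rewrite E memvD ?mem_jac // memvZ -?mem_wedge_jac.
  by rewrite rpredZeq (negPf p0) mem_wedge_jac.
have yT : y \in wedge_jac_space z.
  have := mem_jac x y w; rewrite /jac -/w yw (lieC w) xw wedgexx wedge0l !add0r.
  by rewrite wedgeNl wedgeZl mem_wedge_jac memvN rpredZeq (negPf p0).
have yC' : y \notin C.
  apply/negP => yC'; have [] := ind 0 1; first by rewrite scale0r scale1r add0r.
  by move=> _ /eqP; rewrite oner_eq0.
have dC : (\dim C <= 2)%N.
  rewrite -ltnS; apply: leq_trans T3; apply: dimv_lt_mem yT yC'.
  by apply/subvP => t /CT.
have CE : C = <<[:: w; z]>>%VS.
  apply/esym/eqP; rewrite eqEdim (adapted_dim_plane hA) dC andbT.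
  by apply/span_subvP => t; rewrite !inE => /orP[]/eqP->.
apply: (@filiform_iso _ _ x y w (lie x w)); last first.
  by rewrite (adapted_dim hA) CE (adapted_dim_plane hA).
split=> //.
- by rewrite xw lieZr (centralr _ zc) scaler0.
- by rewrite xw lieZr (centralr _ zc) scaler0.
- by rewrite xw lieZr (centralr _ zc) scaler0.
move=> t; have [a [b h]] := sp t; exists a, b.
move: h; rewrite CE span_cons span_seq1 => /memv_addP[_ /vlineP[c ->] [_ /vlineP[d ->] e]].
exists c, (d / p); rewrite xw scalerA divfK // -addrA -e.
exact: sub2K.
Qed.

(** T contains the centraliser N of x in C, by [jac x a b] for b in N.  If y did not
    centralise some b in N, then T would also contain a, by [jac y b a]; this is
    too much, so a multiple of x corrects y to an element that centralises C.
    Then L has the table of L(4,5,2,4), with at most one further central basis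
    vector b, and dim J is too small if there is none. *)
Lemma adapted_two_step z x y C a : adapted z x y C ->
  central (lie x y) -> a \in C -> lie x a = z ->
  (\dim (wedge_jac_space z) <= 3)%N -> (\dim {:L} = 2 + \dim (jac_space L))%N ->
  lie_isomorphic L (L4524 K * abelian_lie K 1)%type.
Proof.
move=> hA wc aC xa T3 dLr.
have z0 := ada_z0 hA; have zc := ada_zc hA.
have zC := ada_zC hA; have wC := ada_wC hA.
have CC := ada_CC hA.
pose N : {vspace L} := (C :&: lker (ad x))%VS.
have NP b : reflect (b \in C /\ lie x b = 0) (b \in N).
  by rewrite memv_cap memv_ker adE; apply: (iffP andP) => -[? /eqP].
have zN : z \in N by apply/NP; rewrite (centralr _ zc).
have wN : lie x y \in N by apply/NP; rewrite (centralr _ wc).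
have dN : \dim C = (\dim N).+1.
  rewrite -(limg_ker_dim (ad x) C) -/N -addn1; congr (_ + _)%N.
  rewrite (_ : _ @: _ = <[z]>)%VS ?dim_vline ?z0 //; apply/eqP; rewrite eqEsubv.
  rewrite -[X in _ && X]memvE -{2}xa -adE memv_img // andbT.
  by apply/subvP => _ /memv_imgP[t tC ->]; rewrite adE (ada_xC hA).
have NT : (N <= wedge_jac_space z)%VS.
  apply/subvP => b /NP[bC xb]; rewrite mem_wedge_jac.
  have := mem_jac x a b.
  by rewrite /jac xa (CC a b) // (lieC b) xb oppr0 !wedge0l !addr0.
have wzN : (<<[:: lie x y; z]>> <= N)%VS.
  by apply/span_subvP => t; rewrite !inE => /orP[]/eqP->.
have wzc t : t \in <<[:: lie x y; z]>>%VS -> central t.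
  rewrite span_cons span_seq1 => /memv_addP[_ /vlineP[c ->] [_ /vlineP[d ->] ->]] s.
  by rewrite lieDl !lieZl wc zc !scaler0 addr0.
have aN : a \notin N by apply/negP => /NP[_]; rewrite xa; apply/eqP.
have yN b : b \in N -> lie y b = 0.
  move=> bN; have [bC xb] := NP _ bN; apply/eqP/negPn/negP => yb.
  have /vlineP[k ek] := ada_yC hA bC; have /vlineP[q eq] := ada_yC hA aC.
  have k0 : k != 0 by apply: contraNneq yb => k0; rewrite ek k0 scale0r.
  have aT : a \in wedge_jac_space z.
    have E : k *: wedge z a = jac y b a + q *: wedge z b.
      by rewrite /jac ek (CC b a) // (lieC a) eq wedge0l addr0 wedgeNl !wedgeZl subrK.
    have : k *: wedge z a \in jac_space L.
      by rewrite E memvD ?mem_jac // memvZ // -mem_wedge_jac (subvP NT).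
    by rewrite rpredZeq (negPf k0) mem_wedge_jac.
  have bwz : b \notin <<[:: lie x y; z]>>%VS.
    by apply: contraNN yb => /wzc bc; rewrite (centralr _ bc).
  have h1 := dimv_lt_mem wzN bN bwz; rewrite (adapted_dim_plane hA) in h1.
  by have := leq_trans (leq_ltn_trans h1 (dimv_lt_mem NT aT aN)) T3.
have /vlineP[k yk] := ada_yC hA aC.
have hA' := adapted_shift k hA; set y' := y - k *: x in hA'.
have wE : lie x y' = lie x y by rewrite lieDr lieNr lieZr liexx scaler0 oppr0 addr0.
have dL := adapted_dim hA.
have table b : b \in N -> (N <= <<[:: lie x y; z; b]>>)%VS ->
    two_step_table x y' a (lie x y) z b.
  move=> bN Nsub; have [bC xb] := NP _ bN; split=> //.
  - by rewrite lieDl lieNl lieZl yk xa subrr.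
  - by rewrite lieDl lieNl lieZl xb yN // scaler0 subrr.
  - exact: CC.
  - move=> t; have [p [q h]] := ada_split hA' t.
    have /vlineP[s xs] := ada_xC hA h.
    set c := t - _ - _ in h xs.
    have : c - s *: a \in N.
      by apply/NP; rewrite memvB ?memvZ // lieDr lieNr lieZr xs xa subrr.
    move=> /(subvP Nsub); rewrite !span_cons span_nil addv0.
    move=> /memv_addP[_ /vlineP[c3 ->] [_ /memv_addP[_ /vlineP[c4 ->] [_ /vlineP[c5 ->] ->]] e]].
    exists p, q, s, c3, c4, c5.
    have -> : t = p *: x + q *: y' + s *: a + (c - s *: a).
      by apply: vcoord_inj => i; rewrite /c !vcoordE; ring.
    by rewrite e !addrA.
have [Nwz|/subvPn[b bN bwz]] := boolP (N <= <<[:: lie x y; z]>>)%VS.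
  have Nle : (N <= <<[:: lie x y; z; 0%R]>>)%VS.
    apply: subv_trans Nwz _; apply: sub_span => t; rewrite !inE.
    by move=> /orP[]->; rewrite ?orbT.
  have := dim_two_step_jac0 (table 0 (mem0v _) Nle).
  have N2 : \dim N = 2%N.
    by apply/eqP; rewrite eqn_leq -(adapted_dim_plane hA) !dimvS.
  move: dLr; rewrite dL dN N2 => /(congr1 (subn^~ 2)); rewrite addKn => <-.
  by [].
have N3 : \dim N = 3%N.
  apply/eqP; rewrite eqn_leq (leq_trans (dimvS NT) T3) /=.
  by apply: leq_trans (dimv_lt_mem wzN bN bwz); rewrite (adapted_dim_plane hA).
apply: (two_step_iso (table b bN _)); last by rewrite dL dN N3.
have sN : (<<[:: lie x y; z; b]>> <= N)%VS.
  by apply/span_subvP => t; rewrite !inE => /or3P[]/eqP->.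
have /eqP -> // : N == <<[:: lie x y; z; b]>>%VS.
rewrite eq_sym eqEdim sN N3 -[X in (X < _)%N](adapted_dim_plane hA).
apply: dimv_lt_mem bwz; last by rewrite memv_span // !inE eqxx !orbT.
by apply: sub_span => t; rewrite !inE => /orP[]->; rewrite ?orbT.
Qed.

(** A swap of x and y and a shift of y by a multiple of x lead to the two preceding
    lemmas.  If x and y both centralised C, then [L, L] would be the line of
    [x, y]. *)
Theorem adapted_classification z x y C : adapted z x y C ->
  (\dim (wedge_jac_space z) <= 3)%N -> \dim (derived L) = 2%N ->
  (\dim {:L} = 2 + \dim (jac_space L))%N ->
  lie_isomorphic L (L3414 K) \/ lie_isomorphic L (L4524 K * abelian_lie K 1)%type.
Proof.
move=> hA T3 D2 dLr.
wlog xw : x y hA / lie x (lie x y) != 0 \/ central (lie x y).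
  move=> H; have [xw|/negPn/eqP xw] := boolP (lie x (lie x y) != 0).
    by apply: (H x y) => //; left.
  have wE : lie y (- x) = lie x y by rewrite lieNr [lie x y]lieC.
  have [yw|/negPn/eqP yw] := boolP (lie y (lie x y) != 0).
    by apply: (H y (- x)); [exact: adapted_swap | left; rewrite wE].
  apply: (H x y) => //; right => t; have [p [q h]] := ada_split hA t.
  have -> : t = p *: x + q *: y + (t - p *: x - q *: y) by exact: sub2K.
  move: (t - _ - _) h => c cC.
  rewrite !lieDr !lieZr (ada_CC hA (ada_wC hA) cC) lieC xw [lie _ y]lieC yw.
  by rewrite !oppr0 !scaler0 !addr0.
case: xw => [xw|wc].
  left; have /vlineP[p xp] := ada_xC hA (ada_wC hA).
  have /vlineP[q yq] := ada_yC hA (ada_wC hA).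
  have p0 : p != 0 by apply: contraNneq xw => p0; rewrite xp p0 scale0r.
  have wE : lie x (y - (q / p) *: x) = lie x y.
    by rewrite lieDr lieNr lieZr liexx scaler0 oppr0 addr0.
  apply: (adapted_filiform (adapted_shift (q / p) hA)); rewrite ?wE //.
  by rewrite lieDl lieNl lieZl xp yq scalerA divfK // subrr.
right.
have fin x' y' a : adapted z x' y' C -> lie x' y' = lie x y -> a \in C -> lie x' a != 0 ->
    lie_isomorphic L (L4524 K * abelian_lie K 1)%type.
  move=> hA' wE aC xa; have /vlineP[p xp] := ada_xC hA' aC.
  have p0 : p != 0 by apply: contraNneq xa => p0; rewrite xp p0 scale0r.
  apply: (adapted_two_step (a := p^-1 *: a) hA') => //; rewrite ?wE ?memvZ //.
  by rewrite lieZr xp scalerA mulVf // scale1r.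
have [xC|/existsNP[a /not_implyP[aC /eqP]]] := pselect (forall a, a \in C -> lie x a = 0); last first.
  exact: fin hA _ aC.
have [yC|/existsNP[a /not_implyP[aC /eqP]]] := pselect (forall a, a \in C -> lie y a = 0); last first.
  by apply: fin (adapted_swap hA) _ aC; rewrite lieNr [lie x y]lieC.
suff : (\dim (derived L) <= 1)%N by rewrite D2.
have dw : (\dim <[lie x y]> <= 1)%N by rewrite dim_vline; case: (_ != 0).
apply: leq_trans dw; apply: dimvS; apply: derived_sub => u v.
have dec t : exists p q c, c \in C /\ t = p *: x + q *: y + c.
  have [p [q h]] := ada_split hA t; exists p, q, (t - p *: x - q *: y); split=> //.
  exact: sub2K.
have [p [q [c [cC ->]]]] := dec u; have [p' [q' [c' [c'C ->]]]] := dec v.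
rewrite !lieDl !lieDr !lieZl !lieZr !liexx (xC c') // (yC c') // (lieC c x) (lieC c y).
rewrite (xC c) // (yC c) // (ada_CC hA cC c'C) (lieC y x) !oppr0 !scaler0 !addr0 !add0r.
by rewrite !scalerN memvD // ?memvN !memvZ // memv_line.
Qed.

End DerivedPlane.

Section Adapted.
Context (K : fieldType) (L : finLieAlgType K).

(** If L / <z> had two hyperbolic planes, or if dim T > 3, then dim J would exceed
    n - 2.  And a nonzero [a, b] = k z with a, b in C would put k x + c1 and
    k y + c2, with c1, c2 in C, into T, by [jac x a b] and [jac y a b]; together
    with [x, y] and z these are four independent vectors. *)
Lemma adapted_exists : nilpotent_lie L -> \dim (derived L) = 2%N ->
  (\dim {:L} = 2 + \dim (jac_space L))%N ->
  exists z (x y : L) C, adapted z x y C /\ (\dim (wedge_jac_space z) <= 3)%N.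
Proof.
move=> nL D2 dLr.
have [z [z0 zD zc]] : exists z, [/\ z != 0, z \in derived L & central z].
  by apply: nilpotent_center => //; rewrite -dimv_eq0 D2.
have [Q [q [qM qS qK]]] := central_quotient_exists zc.
have dQ := dim_quotient z0 qS qK.
have DQ1 : \dim (derived Q) = 1%N.
  by have := dim_derived_quotient z0 qM qS qK zD; rewrite D2 => -[].
have nQ := nilpotent_quotient qM qS nL.
have rQ := dim_jac_derived1 DQ1.
have rT : (\dim (wedge_jac_space z) + \dim (jac_space Q) <= (\dim (jac_space L)).+1)%N.
  by apply: (dim_jac_quotient z0 qM qS qK) => t; rewrite mem_wedge_jac.
have rD : (2 + \dim (jac_space Q) <= (\dim (jac_space L)).+1)%N.
  by rewrite -D2; apply: (dim_jac_quotient z0 qM qS qK) => t; exact: central_wedge_derived.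
rewrite dLr in dQ.
have T3 : (\dim (wedge_jac_space z) <= 3)%N by move: rT rQ dQ; clear; lia.
have [u [v uv0]] : exists u v : Q, lie u v != 0.
  by apply: derived_neq0; rewrite -dimv_eq0 DQ1.
have perp_abelian a b : a \in perp u v -> b \in perp u v -> lie a b = 0.
  move=> au bu; apply/eqP/negPn/negP => ab0.
  have := dim_jac_two_planes DQ1 uv0 au bu ab0; move: rD dQ; clear; lia.
have uvc : central (lie u v) by exact: derived_line_central nQ DQ1 (mem_derived u v).
have [x xu] := qS u; have [y yv] := qS v.
have qw : q (lie x y) = lie u v by rewrite qM xu yv.
have wz : lie x y \notin <[z]>%VS.
  by apply/negP => /qK; rewrite qw; apply/eqP.
pose C : {vspace L} := ((linfun q : 'Hom(L, Q)) @^-1: perp u v)%VS.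
have CE t : (t \in C) = (q t \in perp u v) by rewrite -memv_preim lfunE.
have qz : q z = 0 by apply/qK; exact: memv_line.
have zC : z \in C by rewrite CE qz mem0v.
have wC : lie x y \in C by rewrite CE qw; apply/perpP; rewrite !(centralr _ uvc).
have xC a : a \in C -> lie x a \in <[z]>%VS.
  by rewrite CE => /perpP[ua _]; apply/qK; rewrite qM xu.
have yC a : a \in C -> lie y a \in <[z]>%VS.
  by rewrite CE => /perpP[_ va]; apply/qK; rewrite qM yv.
have CCz a b : a \in C -> b \in C -> lie a b \in <[z]>%VS.
  by rewrite !CE => au bu; apply/qK; rewrite qM perp_abelian.
have indep p r : p *: x + r *: y \in C -> p = 0 /\ r = 0.
  by rewrite CE linearD !linearZ /= xu yv; exact: (hyperbolic_indep uv0).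
have wzC : (<<[:: lie x y; z]>> <= C)%VS.
  by apply/span_subvP => t; rewrite !inE => /orP[]/eqP->.
exists z, x, y, C; split=> //; split=> // [a b aC bC|t]; last first.
  have [p [r h]] := hyperbolic_split (q t) DQ1 uv0; exists p, r.
  by rewrite CE !linearB [q (p *: x)]linearZ [q (r *: y)]linearZ /= xu yv.
apply/eqP/negPn/negP => ab0.
have /vlineP[k ab] := CCz _ _ aC bC.
have k0 : k != 0 by apply: contraNneq ab0 => k0; rewrite ab k0 scale0r.
(* [jac s a b] = z ^ (k s + c), where c collects the terms of [s, a] and [s, b]. *)
have key s : (forall c, c \in C -> lie s c \in <[z]>%VS) ->
    exists2 c, c \in C & k *: s + c \in wedge_jac_space z.
  move=> sC; have /vlineP[p sa] := sC _ aC; have /vlineP[p' sb] := sC _ bC.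
  exists (p *: b - p' *: a); first by rewrite memvB ?memvZ.
  rewrite mem_wedge_jac (_ : wedge z _ = jac s a b) ?mem_jac //.
  rewrite /jac sa ab (lieC b) sb wedgeNl !wedgeZl !wedgeDr wedgeNr !wedgeZr.
  by rewrite addrA (addrC (k *: _)).
have [c1 c1C x'T] := key x xC; have [c2 c2C y'T] := key y yC.
have wzT : (<<[:: lie x y; z]>> <= wedge_jac_space z)%VS.
  apply/span_subvP => t; rewrite !inE => /orP[]/eqP->; last exact: self_wedge_jac.
  by rewrite mem_wedge_jac central_wedge_derived // mem_derived.
have x'n : k *: x + c1 \notin <<[:: lie x y; z]>>%VS.
  apply/negP => /(subvP wzC) h; have [] := indep k 0; last by move/eqP; rewrite (negPf k0).
  by rewrite scale0r addr0 -(addrK c1 (k *: x)) memvB.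
have y'n : k *: y + c2 \notin (<[k *: x + c1]> + <<[:: lie x y; z]>>)%VS.
  apply/negP => /memv_addP[_ /vlineP[m ->] [s /(subvP wzC) sC e]].
  have [] := indep (- (m * k)) k; last by move=> _ /eqP; rewrite (negPf k0).
  rewrite (_ : _ + _ = s + m *: c1 - c2) ?memvB ?memvD ?memvZ //.
  rewrite -(addrK c2 (k *: y)) e; apply: vcoord_inj => i; rewrite !vcoordE; ring.
have h1 := dimv_lt_mem (addvSr <[k *: x + c1]> _) (subvP (addvSl _ _) _ (memv_line _)) x'n.
rewrite (dim_span2 wz z0) in h1.
have h2 : (<[k *: x + c1]> + <<[:: lie x y; z]>> <= wedge_jac_space z)%VS.
  by rewrite subv_add wzT andbT -memvE.
by have := leq_trans (leq_ltn_trans h1 (dimv_lt_mem h2 y'T y'n)) T3.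
Qed.

(** The converse count: with dim J >= n - 4 for the quotient, three vectors in T
    are enough. *)
Lemma dim_jac_derived2 (z : L) : z != 0 -> central z -> z \in derived L ->
  \dim (derived L) = 2%N -> (3 <= \dim (wedge_jac_space z))%N ->
  (\dim {:L} <= 2 + \dim (jac_space L))%N.
Proof.
move=> z0 zc zD D2 T3.
have [Q [q [qM qS qK]]] := central_quotient_exists zc.
have dQ := dim_quotient z0 qS qK.
have DQ1 : \dim (derived Q) = 1%N.
  by have := dim_derived_quotient z0 qM qS qK zD; rewrite D2 => -[].
have rQ := dim_jac_derived1 DQ1.
have rT : (\dim (wedge_jac_space z) + \dim (jac_space Q) <= (\dim (jac_space L)).+1)%N.
  by apply: (dim_jac_quotient z0 qM qS qK) => t; rewrite mem_wedge_jac.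
by rewrite dQ; move: T3 rQ rT; clear; lia.
Qed.

Lemma filiform_dims (x y w z : L) : filiform_table x y w z ->
  w \notin <[z]>%VS -> z != 0 -> y \notin <<[:: w; z]>>%VS -> \dim {:L} = 4%N ->
  (\dim (derived L) + \dim (jac_space L) = \dim {:L})%N.
Proof.
move=> tab wz z0 ywz dL; case: (tab) => xy xw xz yw yz wz' sp.
have wD : w \in derived L by rewrite -xy mem_derived.
have zD : z \in derived L by rewrite -xw mem_derived.
have zc : central z.
  move=> t; have [a [b [c [d ->]]]] := sp t.
  by rewrite !lieDr !lieZr liexx [lie z x]lieC [lie z y]lieC [lie z w]lieC xz yz wz' !oppr0 !scaler0 !addr0.
have DE : derived L = <<[:: w; z]>>%VS.
  apply/eqP; rewrite eqEsubv; apply/andP; split.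
    apply: derived_sub => u v; have [a [b [c [d ->]]]] := sp u.
    have [a' [b' [c' [d' ->]]]] := sp v; rewrite filiform_lie //.
    by rewrite memvD // memvZ // memv_span // !inE eqxx ?orbT.
  by apply/span_subvP => t; rewrite !inE => /orP[]/eqP->.
have D2 : \dim (derived L) = 2%N by rewrite DE dim_span2.
have yT : y \in wedge_jac_space z.
  have := mem_jac x y w.
  by rewrite /jac xy yw (lieC w) xw wedgexx wedge0l !add0r wedgeNl memvN mem_wedge_jac.
have wzT : (<<[:: w; z]>> <= wedge_jac_space z)%VS.
  by rewrite -DE; apply/subvP => t tD; rewrite mem_wedge_jac central_wedge_derived.
have := dimv_lt_mem wzT yT ywz; rewrite dim_span2 // => T3.
have := dim_jac_derived2 z0 zc zD D2 T3; have := filiform_jac tab.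
by rewrite D2 dL; clear; lia.
Qed.

Lemma two_step_dims (x y a w z b : L) : two_step_table x y a w z b ->
  w \notin <[z]>%VS -> z != 0 -> b \notin <<[:: w; z]>>%VS -> \dim {:L} = 6%N ->
  (\dim (derived L) + \dim (jac_space L) = \dim {:L})%N.
Proof.
move=> tab wz z0 bwz dL; case: (tab) => xy xa xb ya yb ab wc zc sp.
have wD : w \in derived L by rewrite -xy mem_derived.
have zD : z \in derived L by rewrite -xa mem_derived.
have DE : derived L = <<[:: w; z]>>%VS.
  apply/eqP; rewrite eqEsubv; apply/andP; split.
    apply: derived_sub => u v; have [c0 [c1 [c2 [c3 [c4 [c5 ->]]]]]] := sp u.
    have [d0 [d1 [d2 [d3 [d4 [d5 ->]]]]]] := sp v; rewrite (two_step_lie tab).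
    by rewrite memvD // memvZ // memv_span // !inE eqxx ?orbT.
  by apply/span_subvP => t; rewrite !inE => /orP[]/eqP->.
have D2 : \dim (derived L) = 2%N by rewrite DE dim_span2.
have bT : b \in wedge_jac_space z.
  have := mem_jac x a b.
  by rewrite /jac xa ab (lieC b) xb oppr0 !wedge0l !addr0 mem_wedge_jac.
have wzT : (<<[:: w; z]>> <= wedge_jac_space z)%VS.
  by rewrite -DE; apply/subvP => t tD; rewrite mem_wedge_jac central_wedge_derived.
have := dimv_lt_mem wzT bT bwz; rewrite dim_span2 // => T3.
have := dim_jac_derived2 z0 zc zD D2 T3; have := dim_two_step_jac tab.
by rewrite D2 dL; clear; lia.
Qed.

End Adapted.

(** * The models and the classification *)

Section Models.
Context (K : fieldType).

Lemma L3414_dims :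
  (\dim (derived (L3414 K)) + \dim (jac_space (L3414 K)) = \dim {:L3414 K})%N.
Proof.
pose e i : L3414 K := delta_mx 0 i.
have br (u v : L3414 K) : lie u v = L3414_br u v by [].
have eqv (u v : L3414 K) : (forall i, u 0 i = v 0 i) -> u = v by move=> h; apply/rowP.
have coord2 t : t \in <<[:: e 2; e 3]>>%VS -> t 0 1 = 0.
  rewrite span_cons span_seq1 => /memv_addP[_ /vlineP[c ->] [_ /vlineP[d ->] ->]].
  by rewrite !mxE /= !mulr0 addr0.
apply: (@filiform_dims _ _ (e 0) (e 1) (e 2) (e 3)).
- split; try by apply: eqv => i; rewrite br /e !mxE /=; ring.
  move=> t; exists (t 0 0), (t 0 1), (t 0 2), (t 0 3).
  apply: eqv => i; rewrite !mxE.
  by case: i => -[|[|[|[|//]]]] ?; rewrite /= ?mulr0 ?mulr1 ?addr0 ?add0r; congr (t _ _); apply: val_inj.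
- apply/negP => /vlineP[c] /rowP/(_ 2) /eqP; rewrite !mxE /= mulr0 oner_eq0 //.
- by apply/eqP => /rowP/(_ 3) /eqP; rewrite !mxE /= oner_eq0.
- by apply/negP => /coord2 /eqP; rewrite !mxE /= oner_eq0.
- by rewrite dimvf.
Qed.

Lemma L4524_dims : let M : finLieAlgType K := (L4524 K * abelian_lie K 1)%type in
  (\dim (derived M) + \dim (jac_space M))%N = \dim {:M}.
Proof.
move=> M; pose e i : M := (delta_mx 0 i, 0); pose b : M := (0, delta_mx 0 0).
have br (u v : M) : lie u v = (L4524_br u.1 v.1, 0) by [].
have eqv (u v : M) : (forall i, u.1 0 i = v.1 0 i) -> u.2 0 0 = v.2 0 0 -> u = v.
  case: u v => [u1 u2] [v1 v2] /= h1 h2; congr (_, _); apply/rowP => i //.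
  by rewrite ord1.
have coordb t : t \in <<[:: e 3; e 4]>>%VS -> t.2 0 0 = 0.
  rewrite span_cons span_seq1 => /memv_addP[_ /vlineP[c ->] [_ /vlineP[d ->] ->]].
  by rewrite !mxE /= !mulr0 addr0.
apply: (@two_step_dims _ _ (e 0) (e 1) (e 2) (e 3) (e 4) b).
- split; try by apply: eqv => [i|]; rewrite br /e /b !mxE //=; ring.
  + by move=> t; apply: eqv => [i|]; rewrite br /e /b !mxE //=; ring.
  + by move=> t; apply: eqv => [i|]; rewrite br /e /b !mxE //=; ring.
  move=> t; exists (t.1 0 0), (t.1 0 1), (t.1 0 2), (t.1 0 3), (t.1 0 4), (t.2 0 0).
  apply: eqv => [i|]; rewrite !mxE; last by rewrite /= !mulr0 mulr1 !add0r.
  by case: i => -[|[|[|[|[|//]]]]] ?; rewrite /= ?mulr0 ?mulr1 ?addr0 ?add0r; congr (t.1 _ _); apply: val_inj.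
- by apply/negP => /vlineP[c] /(congr1 (fun u : M => u.1 0 3)) /eqP; rewrite !mxE /= mulr0 oner_eq0.
- by apply/eqP => /(congr1 (fun u : M => u.1 0 4)) /eqP; rewrite !mxE /= oner_eq0.
- by apply/negP => /coordb /eqP; rewrite !mxE /= oner_eq0.
- by rewrite dimvf.
Qed.
End Models.

(** Hopf's formula, with 'C(n, 2) - (n - 1) (n - 2) / 2 = n - 1. *)
Lemma s_invariantE (K : fieldType) (L : finLieAlgType K) (P : free_presentation L) :
  (0 < \dim {:L})%N ->
  s_invariant P = 2 +
    ((\dim (derived L) + \dim (jac_space L))%N%:R - (\dim {:L})%:R : rat).
Proof.
move=> n0; rewrite /s_invariant.
have := hopf_formula P; have := mul_bin_diag (\dim {:L}) 1.
move: n0; case: (\dim {:L}) => // n _; rewrite bin1 /= => e h.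
have : ((2 * 'C(n.+1, 2))%N%:R : rat) = (n.+1 * n)%N%:R by rewrite -e.
rewrite -h !natrM !natrD -[n.+1%:R]natr1 => E.
move: E; set m := (\dim _)%:R; set r := (\dim _)%:R; set s := (schur_dim P)%:R => E.
have -> : s = 2^-1 * ((n%:R + 1) * n%:R) - m - r by rewrite -E; field.
by field.
Qed.

Theorem theorem2p7 (K : fieldType) (n : nat) (L : finLieAlgType K)
    (P : free_presentation L) :
  (0 < n)%N -> \dim {:L} = n -> nilpotent_lie L ->
  (s_invariant P = 2 <->
   [\/ lie_isomorphic L (L3414 K),
       lie_isomorphic L (L4524 K * abelian_lie K 1)%type
     | exists m : nat, [/\ (2 <= m)%N, (2 * m + 1 <= n)%N &
         lie_isomorphic L (heisenberg K m * abelian_lie K (n - 2 * m - 1))%type]]).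
Proof.
move=> n0 dL nL.
have -> : s_invariant P = 2 <->
    (\dim (derived L) + \dim (jac_space L) = \dim {:L})%N.
  rewrite s_invariantE ?dL //; split=> [/eqP|->]; last by rewrite subrr addr0.
  by rewrite -subr_eq0 addrAC subrr add0r subr_eq0 Num.Theory.eqr_nat => /eqP.
split=> [e|]; last first.
  case=> [iso|iso|[m [m2 mn iso]]]; have [-> -> ->] := isomorphic_dims iso.
  - exact: L3414_dims.
  - exact: L4524_dims.
  - exact: heisenberg_dims.
have [D0|D0] := eqVneq (derived L) 0%VS.
  have br (u v : L) : lie u v = 0 by apply/eqP; rewrite -memv0 -D0 mem_derived.
  by move: e n0; rewrite abelian_dims // dL => <-.
have lower := dim_jac_lower nL D0.
have [D1|D1] := eqVneq (\dim (derived L)) 1%N.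
  have [p [k [p2 dLp iso]]] := derived_line_classification nL D1 e.
  apply: Or33; exists p; rewrite -dL dLp; split=> //; first by rewrite leq_addr.
  by have -> : (2 * p + 1 + k - 2 * p - 1 = k)%N by lia.
have D2 : \dim (derived L) = 2%N.
  move: lower D0 D1; rewrite -e -dimv_eq0; case: (\dim (derived L)) => [|[|[|m]]] // + _ _.
  rewrite !binS !bin0 bin1 => h; exfalso; move: h; clear; lia.
have e2 : \dim {:L} = (2 + \dim (jac_space L))%N by rewrite -e D2.
have [z [x [y [C [hA T3]]]]] := adapted_exists nL D2 e2.
have [iso|iso] := adapted_classification hA T3 D2 e2.
- exact: Or31.
- exact: Or32.
Qed.
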